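(* Let $R$ be an integral domain with $\operatorname{char} R\neq 2$. Let $\mathcal{A}_1$ and $\mathcal{A}_2$ be central real hyperplane arrangements, and suppose that $\mathcal{A}_1$ is generic in codimension $2$. If $\mathrm{gr}\mathrm{VG}^\bullet(\mathcal{A}_1)_R$ and $\mathrm{gr}\mathrm{VG}^\bullet(\mathcal{A}_2)_R$ are isomorphic as graded $R$-algebras, then the sets of signed circuits of $\mathcal{A}_1$ and $\mathcal{A}_2$ are isomorphic.
   Context: A central real arrangement $\mathcal{A}=\{H_1,\dots,H_n\}$ is a finite set of distinct linear hyperplanes in $V=\mathbb{R}^\ell$, $H_i=\alpha_i^{-1}(0)$ with chosen $\alpha_i\in V^*$; $H_i^\pm=\alpha_i^{-1}(\mathbb{R}_{\gtrless 0})$. Chambers $\mathrm{ch}(\mathcal{A})$ are the connected components of $V\setminus\bigcup_i H_i$. $\mathrm{VG}(\mathcal{A})_R$ is the $R$-algebra of all functions $\mathrm{ch}(\mathcal{A})\to R$ (pointwise operations). The Heaviside function $x_i^+$ is $1$ on chambers in $H_i^+$ and $0$ elsewhere. The filtration: $\mathrm{Fil}^{-1}=0$, and $\mathrm{Fil}^k$ ($k\ge0$) is the set of $G(x_1^+,\dots,x_n^+)$ with $G\in R[z_1,\dots,z_n]$ of degree $\le k$. The graded VG algebra is $\mathrm{gr}\mathrm{VG}^\bullet(\mathcal{A})_R=\bigoplus_{k\ge0}\mathrm{Fil}^k/\mathrm{Fil}^{k-1}$ with multiplication induced from $\mathrm{VG}(\mathcal{A})$. A circuit is a minimal subset $I\subseteq[n]$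 with $\{\alpha_i\}_{i\in I}$ linearly dependent; for such $I$ and a nontrivial relation $\sum_{i\in I}\lambda_i\alpha_i=0$ the sign vector $(\operatorname{sgn}\lambda_1,\dots,\operatorname{sgn}\lambda_n)\in\{+,-,0\}^n$ (with $\lambda_i=0$ for $i\notin I$) is a signed circuit; the set of all signed circuits is denoted $\mathcal{C}(\mathcal{A})$. Two sets of signed circuits $\mathcal{C}_1\subseteq\{+,-,0\}^{n}$, $\mathcal{C}_2\subseteq\{+,-,0\}^{n}$ are isomorphic if there is a permutation $\pi$ of $[n]$ and signs $\varepsilon_1,\dots,\varepsilon_n\in\{\pm1\}$ such that $(\sigma_i)_i\mapsto(\varepsilon_i\sigma_{\pi(i)})_i$ maps $\mathcal{C}_2$ bijectively onto $\mathcal{C}_1$. $\mathcal{A}$ is generic in codimension $2$ if every codimension-$2$ intersection of hyperplanes of $\mathcal{A}$ is contained in exactly two hyperplanes of $\mathcal{A}$. *)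

(* Defs.v *)
From HB Require Import structures.
From mathcomp Require Import all_boot all_order all_algebra.
From mathcomp Require Import all_classical all_reals all_analysis.
From mathcomp Require Import ring_quotient.
From mathcomp Require mpoly.
(* The notations of mpoly clash with those of analysis. *)
Import (canonicals, coercions, hints) mpoly.

Set Implicit Arguments.
Unset Strict Implicit.
Unset Printing Implicit Defensive.

Import Order.TTheory GRing.Theory Num.Theory.
Import numFieldNormedType.Exports.

Local Open Scope quotient_scope.
Local Open Scope classical_set_scope.
Local Open Scope ring_scope.

Record arrangement (K : realType) (l n : nat) := Arrangement {
  form :> 'I_n -> 'Hom('rV[K]_l, K^o);
  form_neq0 : forall i, form i != 0;
  form_distinct : injective (fun i => lker (form i)) }.

Section Arrangement.
Variables (K : realType) (l n : nat) (A : arrangement K l n).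
Implicit Types (i : 'I_n) (I : {set 'I_n}) (s : {ffun 'I_n -> int}).

Definition hyperplane i : {vspace 'rV[K]_l} := lker (A i).

Definition halfspace i : set 'rV[K]_l := [set v | 0 < (A i v : K)].

Definition arr_complement : set 'rV[K]_l :=
  ~` \bigcup_i [set v | v \in hyperplane i].

Definition chambers : set (set 'rV[K]_l) :=
  connected_component arr_complement @` arr_complement.

Definition flat I : {vspace 'rV[K]_l} := (\bigcap_(i in I) hyperplane i)%VS.

Definition generic_codim2 : Prop :=
  forall I, (\dim (flat I) + 2 = l)%N ->
    #|[set i | (flat I <= hyperplane i)%VS]%SET| = 2%N.

Definition circuit I : bool :=
  minset (fun J : {set 'I_n} => ~~ free [seq A i | i in J]) I.

(* The signs +, -, 0 are the integers 1, -1, 0. *)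
Definition signed_circuits : set {ffun 'I_n -> int} :=
  [set s | exists I, circuit I /\ exists lambda : 'I_n -> K,
    [/\ exists i, lambda i != 0,
        forall i, i \notin I -> lambda i = 0,
        \sum_(i in I) lambda i *: A i = 0
      & s = [ffun i => sgz (lambda i)]]].

End Arrangement.

(* A bijection between the two index sets forces n1 = n2. *)
Definition signed_circuits_isom (n1 n2 : nat)
    (C1 : set {ffun 'I_n1 -> int}) (C2 : set {ffun 'I_n2 -> int}) : Prop :=
  exists (p : 'I_n1 -> 'I_n2) (e : 'I_n1 -> bool), bijective p /\
    set_bij C2 C1 (fun s => [ffun i => (-1) ^+ e i * s (p i)]).

Section QuotientModule.
Variables (R : pzRingType) (V : lmodType R) (N : submodClosed V).

Fact submod_zmod_closed : zmod_closed N.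
Proof.
split=> [|x y Nx Ny]; first exact: rpred0.
by rewrite rpredD // -scaleN1r rpredZ.
Qed.

Definition submod_zmodClosed : zmodClosed V :=
  HB.pack_for (zmodClosed V) (N : {pred V})
    (GRing.isZmodClosed.Build V (N : {pred V}) submod_zmod_closed).

Definition lquot : Type := Quotient.quot submod_zmodClosed.
HB.instance Definition _ := GRing.Zmodule.on lquot.
HB.instance Definition _ := EqQuotient.on lquot.

Lemma lquot_eqP (x y : V) :
  reflect (\pi_lquot x = \pi_lquot y) (x - y \in N).
Proof. by rewrite (Quotient.idealrBE submod_zmodClosed); exact: eqP. Qed.

Definition lquot_scale (a : R) (x : lquot) : lquot := \pi_lquot (a *: repr x).

Lemma pi_lquotD (x y : V) : \pi_lquot (x + y) = \pi_lquot x + \pi_lquot y.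
Proof. exact: (raddfD (\pi_(Quotient.quot submod_zmodClosed))). Qed.

Lemma pi_lquotZ (a : R) (x : V) : lquot_scale a (\pi_lquot x) = \pi_lquot (a *: x).
Proof.
apply/lquot_eqP; rewrite -scalerBr rpredZ //.
by apply/lquot_eqP; rewrite reprK.
Qed.

Fact lquot_scaleA a b (x : lquot) :
  lquot_scale a (lquot_scale b x) = lquot_scale (a * b) x.
Proof. by elim/quotW: x => x; rewrite (pi_lquotZ b) !pi_lquotZ scalerA. Qed.

Fact lquot_scale1 : left_id 1 lquot_scale.
Proof. by elim/quotW=> x; rewrite pi_lquotZ scale1r. Qed.

Fact lquot_scaleDr : right_distributive lquot_scale +%R.
Proof.
move=> a; elim/quotW=> x; elim/quotW=> y; rewrite -pi_lquotD !pi_lquotZ.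
by rewrite scalerDr pi_lquotD.
Qed.

Fact lquot_scaleDl x : {morph lquot_scale^~ x : a b / a + b}.
Proof. by elim/quotW: x => x a b; rewrite !pi_lquotZ scalerDl pi_lquotD. Qed.

HB.instance Definition _ := GRing.Zmodule_isLmodule.Build R lquot
  lquot_scaleA lquot_scale1 lquot_scaleDr lquot_scaleDl.

End QuotientModule.

Section VarchenkoGelfand.
Variables (R : idomainType) (K : realType) (l n : nat).
Variable (A : arrangement K l n).

(* Functions on the chambers, with the pointwise structures; R^o is R as a
   module over itself. *)
Definition VG : Type := chambers A -> R^o.
HB.instance Definition _ := GRing.ComPzRing.on VG.
HB.instance Definition _ := GRing.Lmodule.on VG.

Definition heaviside (i : 'I_n) : VG :=
  fun C => if `[< val C `<=` halfspace A i >] then 1 else 0.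

Definition poly_heaviside (G : mpoly.mpoly n R) : VG :=
  fun C => mpoly.meval (fun i => heaviside i C) G.

(* mpoly.msize is the total degree plus one, and 0 for the zero polynomial. *)
Definition Fil (k : int) : set VG :=
  match k with
  | Posz d => [set f | exists2 G : mpoly.mpoly n R,
                 (mpoly.msize G <= d.+1)%N & f = poly_heaviside G]
  | Negz _ => [set 0]
  end.

Definition Fil_pred (k : int) : {pred VG} := fun f => `[< Fil k f >].

Fact Fil_submod_closed k : submod_closed (Fil_pred k).
Proof.
split.
  apply/asboolP; case: k => d //=; exists 0; first by rewrite mpoly.msize0.
  by apply/funext => C; rewrite /poly_heaviside mpoly.meval0.
move=> a f g /asboolP Ff /asboolP Fg; apply/asboolP.
case: k Ff Fg => d /=; last by move=> -> ->; rewrite scaler0 addr0.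
move=> [F dF ->] [G dG ->]; exists (a *: F + G).
  apply: leq_trans (mpoly.msizeD_le _ _) _.
  by rewrite geq_max dG (leq_trans (mpoly.mmeasureZ_le _ _ _)).
by apply/funext => C; rewrite /poly_heaviside mpoly.mevalD mpoly.mevalZ.
Qed.
HB.instance Definition _ k :=
  GRing.isSubmodClosed.Build R VG (Fil_pred k) (Fil_submod_closed k).

Record filVG (k : nat) := FilVG { filVG_val : VG; _ : filVG_val \in Fil_pred k }.
HB.instance Definition _ k := [isSub for @filVG_val k].
HB.instance Definition _ k := [Choice of filVG k by <:].
HB.instance Definition _ k := [SubChoice_isSubLmodule of filVG k by <:].

Definition Fil_prev (k : nat) : {pred filVG k} :=
  fun f => val f \in Fil_pred (k%:Z - 1).

Fact Fil_prev_submod_closed k : submod_closed (@Fil_prev k).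
Proof.
split=> [|a f g Ff Fg].
  by change (val (0 : filVG k) \in Fil_pred (k%:Z - 1)); rewrite raddf0 rpred0.
change (val (a *: f + g) \in Fil_pred (k%:Z - 1)).
by rewrite linearP rpredD ?rpredZ.
Qed.
HB.instance Definition _ k :=
  GRing.isSubmodClosed.Build R (filVG k) (@Fil_prev k)
    (Fil_prev_submod_closed k).

Definition grVG (k : nat) : Type := lquot (@Fil_prev k).
HB.instance Definition _ k := GRing.Lmodule.on (grVG k).
HB.instance Definition _ k := EqQuotient.on (grVG k).

Definition gr_class (k : nat) (f : filVG k) : grVG k := \pi_(grVG k) f.

Lemma Fil_mul (i j : int) f g :
  f \in Fil_pred i -> g \in Fil_pred j -> f * g \in Fil_pred (i + j).
Proof.
case: i => [i|i]; last first.
  by move=> /asboolP -> _; rewrite mul0r rpred0.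
case: j => [j|j]; last first.
  by move=> _ /asboolP ->; rewrite mulr0 rpred0.
move=> /asboolP [F dF ->] /asboolP [G dG ->].
apply/asboolP; exists (F * G); last first.
  by apply/funext => C; rewrite /poly_heaviside mpoly.mevalM.
have [->|F0] := eqVneq F 0; first by rewrite mul0r mpoly.msize0.
have [->|G0] := eqVneq G 0; first by rewrite mulr0 mpoly.msize0.
rewrite mpoly.msizeM // -subn1 leq_subLR add1n.
by rewrite (leq_trans (leq_add dF dG)) // addSn addnS.
Qed.

Fact filVG_mul_subproof i j (f : filVG i) (g : filVG j) :
  val f * val g \in Fil_pred (i + j)%N.
Proof. by rewrite PoszD; apply: Fil_mul; exact: valP. Qed.

Definition filVG_mul i j (f : filVG i) (g : filVG j) : filVG (i + j) :=
  FilVG (filVG_mul_subproof f g).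

Fact filVG_one_subproof : 1 \in Fil_pred 0%N.
Proof.
apply/asboolP; exists 1; first by rewrite mpoly.msize1.
by apply/funext => C; rewrite /poly_heaviside mpoly.meval1.
Qed.

Definition filVG_one : filVG 0 := FilVG filVG_one_subproof.

Definition gr_one : grVG 0 := gr_class filVG_one.

Definition gr_mul i j (x : grVG i) (y : grVG j) : grVG (i + j) :=
  gr_class (filVG_mul (repr x) (repr y)).

Lemma gr_mulE i j (f : filVG i) (g : filVG j) :
  gr_mul (gr_class f) (gr_class g) = gr_class (filVG_mul f g).
Proof.
have repr_prev k (h : filVG k) :
    val (repr (gr_class h)) - val h \in Fil_pred (k%:Z - 1).
  rewrite -raddfB; change (repr (gr_class h) - h \in @Fil_prev k).
  by apply/lquot_eqP; exact: (@reprK _ (grVG k)).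
apply/lquot_eqP; set f' := repr _; set g' := repr _.
change (val (filVG_mul f' g' - filVG_mul f g) \in Fil_pred ((i + j)%N%:Z - 1)).
have -> : val (filVG_mul f' g' - filVG_mul f g) =
    (val f' - val f) * val g' + val f * (val g' - val g).
  by rewrite raddfB /= mulrBl mulrBr addrA subrK.
rewrite rpredD // PoszD; last first.
  by rewrite -addrA Fil_mul //; [exact: valP | exact: repr_prev].
by rewrite addrAC Fil_mul //; [exact: repr_prev | exact: valP].
Qed.

End VarchenkoGelfand.

(* An isomorphism of graded R-algebras, given by its homogeneous components. *)
Definition grVG_isom (R : idomainType) (K : realType) (l1 n1 l2 n2 : nat)
    (A1 : arrangement K l1 n1) (A2 : arrangement K l2 n2) : Prop :=
  exists phi : forall k, {linear grVG R A1 k -> grVG R A2 k},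
    [/\ forall k, bijective (phi k),
        phi 0%N (gr_one R A1) = gr_one R A2
      & forall i j (x : grVG R A1 i) (y : grVG R A1 j),
          phi (i + j)%N (gr_mul x y) = gr_mul (phi i x) (phi j y)].

(* Main.v *)
(* In degree one the graded algebra has the basis x_i of classes of Heaviside
   functions. To linearly independent forms alpha_1, ..., alpha_k one attaches an
   alternating sum, over signs e, of the values at the points
   p + e_1 t w_1 + ... + e_k t^k w_k (w the dual basis, p generic in the flat, t
   small): it kills Fil^(k-1) and its value on a product of k Heaviside functions
   is 0 or a sign. These residues show that x_I is nonzero in the graded algebra
   iff I is independent, that in codimension-2 generic arrangements the x_i x_j
   (i < j) are linearly independent, and that for a circuit I with signs s the
   only relations among the x_(I - i) are the multiples of
   sum_i s_i x_(I - i) = 0.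

   If A1 is generic in codimension 2 and char R <> 2, the square-zero elements of
   degree one are the multiples of the x_i. As the generators x'_j of the second
   algebra square to zero, the isomorphism maps some c_j x_(rho j) to x'_j, and rho
   is a bijection preserving independence, hence circuits. Comparing the relation
   of a circuit J with that of rho J shows that c_i and c_j agree up to sign for i, j
   in J, the sign being the discrepancy of the two signed circuits; choosing
   representatives of the c_j up to sign gives the reorientation. *)
From HB Require Import structures.
Require Import Defs.
From mathcomp Require Import all_boot all_order all_algebra.
From mathcomp Require Import all_classical all_reals all_analysis.
From mathcomp Require mpoly.
From mathcomp Require Import ring lra.
Import (canonicals, coercions, hints) mpoly.
Import Order.TTheory GRing.Theory Num.Theory.
Import numFieldNormedType.Exports.
Set Implicit Arguments.
Unset Strict Implicit.
Unset Printing Implicit Defensive.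
Local Open Scope ring_scope.

(** * Generic points, chambers and values of Heaviside functions *)

Lemma linear_comb_coord_continuous (K : numFieldType) (l : nat) (c : 'I_l -> K) r :
  continuous (fun v : 'rV[K]_l => \sum_(j <- r) v 0 j * c j).
Proof.
elim: r => [|j r IHr] v.
  have -> : (fun v : 'rV[K]_l => \sum_(j <- [::]) v 0 j * c j) = (fun=> 0).
    by apply/funext => w; rewrite big_nil.
  exact: cst_continuous.
have -> : (fun v : 'rV[K]_l => \sum_(j0 <- j :: r) v 0 j0 * c j0) =
    (fun v => v 0 j * c j + \sum_(j0 <- r) v 0 j0 * c j0).
  by apply/funext => w; rewrite big_cons.
apply: continuousD (IHr v).
apply: (@continuousM K _ (fun w : 'rV[K]_l => w 0 j) (fun=> c j) v).
  exact: coord_continuous.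
exact: cst_continuous.
Qed.

Section Points.
Variables (K : realType) (l n : nat) (A : arrangement K l n).
Implicit Types (v w : 'rV[K]_l) (i j : 'I_n).

Definition generic_point v := forall j, (A j v : K) != 0.

Lemma form_continuous i : continuous (fun v => A i v : K).
Proof.
have <- : (fun v : 'rV[K]_l => \sum_(j <- index_enum 'I_l) v 0 j * A i (delta_mx 0 j)) =
    (fun v => A i v : K).
  apply/funext => v; rewrite [in RHS](row_sum_delta v) linear_sum.
  by apply: eq_bigr => j _; rewrite linearZ.
exact: linear_comb_coord_continuous.
Qed.

Lemma generic_point_complement v : generic_point v -> arr_complement A v.
Proof. by move=> gv [i _ /=]; rewrite memv_ker; apply/negP; exact: gv. Qed.

Lemma complement_generic_point v : arr_complement A v -> generic_point v.
Proof.
by move=> cv i; apply/negP => /eqP Aiv; apply: cv; exists i => //=; rewrite memv_ker Aiv.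
Qed.

Definition chamber_of v (gv : generic_point v) : chambers A.
Proof.
exists (connected_component (arr_complement A) v).
by rewrite inE; exists v => //; exact: generic_point_complement.
Defined.

(** A chamber is connected and avoids the hyperplanes, so a form maps it to an interval without 0:
    the sign at one point decides the sign on the whole chamber. *)
Lemma chamber_in_halfspace v i : arr_complement A v ->
  (connected_component (arr_complement A) v `<=` halfspace A i)%classic
  <-> 0 < (A i v : K).
Proof.
move=> cv; split=> [|Aiv w Cw]; first by apply; exact: connected_component_refl.
rewrite /halfspace /= ltNge; apply/negP => Aiw.
have /connected_intervalP itv : connected
    ((fun u => A i u : K) @` connected_component (arr_complement A) v)%classic.
  apply: connected_continuous_connected; first exact: component_connected.
  by apply: continuous_subspaceT; exact: form_continuous.
have [|||u Cu Au] := itv (A i w : K) (A i v : K) _ _ 0.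
- by exists w.
- by exists v => //; exact: connected_component_refl.
- by rewrite Aiw ltW.
- by have /complement_generic_point/(_ i)/eqP := connected_component_sub Cu.
Qed.

Lemma chamber_surj (C : chambers A) : exists v (gv : generic_point v),
  C = chamber_of gv.
Proof.
case: C => C CA; have [v cv vC] := set_mem CA.
exists v, (complement_generic_point cv); exact/val_inj.
Qed.

End Points.

Section Heaviside.
Variables (R : idomainType) (K : realType) (l n : nat) (A : arrangement K l n).

Lemma heaviside_chamber_of v (gv : generic_point A v) i :
  heaviside R i (chamber_of gv) = ((0 < (A i v : K))%R : bool)%:R.
Proof.
rewrite /heaviside /=; case: asboolP => [|] /(chamber_in_halfspace _ (generic_point_complement gv)).
  by move=> ->.
by move/negP/negbTE => ->.
Qed.

End Heaviside.

(** * Sign vectors at points near a flat *)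

Lemma sgr_addl_small (K : realDomainType) (a b : K) :
  `|b| < `|a| -> Num.sg (a + b) = Num.sg a.
Proof.
have [a0|a0|<-] := ltgtP 0 a; last by rewrite normr0 ltNge normr_ge0.
- by rewrite (gtr0_norm a0) ltr_norml => /andP[ab _]; rewrite !gtr0_sg //; lra.
- by rewrite (ltr0_norm a0) ltr_norml => /andP[_ ab]; rewrite !ltr0_sg //; lra.
Qed.

Lemma mulmx_col (K : pzSemiRingType) m p q (M : 'M[K]_(m, p)) (N : 'M[K]_(p, q)) b :
  M *m col b N = col b (M *m N).
Proof. by rewrite !colE mulmxA. Qed.

Section Frame.
Variables (K : realType) (l n : nat) (A : arrangement K l n).
Implicit Types (v w : 'rV[K]_l) (i j : 'I_n).

(** If [A j] kills all of [ws] this is 0, by the default of [nth]. *)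
Definition lead_value (ws : seq 'rV[K]_l) j : K :=
  A j (nth 0 ws (find (fun w => (A j w : K) != 0) ws)).

(* v is w1 + t w2 + t^2 w3 + ... for a small t > 0, with ws = [:: w1; w2; ...]. *)
Lemma lex_point (ws : seq 'rV[K]_l) :
  exists v, forall j, Num.sg (A j v : K) = Num.sg (lead_value ws j).
Proof.
elim: ws => [|w ws [v vws]]; first by exists 0.
(* [T] exceeds every ratio [|A j v| / |A j w|], so adding [T^-1 *: v] to [w] changes no nonzero
   sign; a ratio with denominator 0 counts as 0. *)
pose T := 1 + \sum_j `|A j v : K| / `|A j w : K|.
have T0 : 0 < T.
  by rewrite ltr_pwDl // sumr_ge0 // => j _; rewrite divr_ge0.
exists (w + T^-1 *: v) => j; rewrite /lead_value /= linearD linearZ /=.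
have [Ajw|Ajw] := eqVneq (A j w : K) 0 => /=.
  rewrite Ajw add0r sgrM gtr0_sg ?invr_gt0 // mul1r; exact: vws.
apply: sgr_addl_small; rewrite normrM gtr0_norm ?invr_gt0 //.
rewrite mulrC ltr_pdivrMr // mulrC -ltr_pdivrMr ?normr_gt0 //.
rewrite /T (bigD1 j) //= addrCA ltrDl ltr_pwDl //.
by rewrite sumr_ge0 // => i _; rewrite divr_ge0.
Qed.

Definition independent k (bs : k.-tuple 'I_n) :=
  forall c : 'I_k -> K, \sum_a c a *: A (tnth bs a) = 0 -> forall a, c a = 0.

Definition form_row j : 'rV[K]_l := \row_b A j (delta_mx 0 b).

Lemma form_rowE j v : A j v = (form_row j *m v^T) 0 0.
Proof.
rewrite [in LHS](row_sum_delta v) linear_sum mxE.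
by apply: eq_bigr => b _; rewrite linearZ !mxE; exact: mulrC.
Qed.

(** A right inverse of the coefficient matrix [B] supplies the dual vectors [w]; the columns of its
    cokernel supply [P], which spans the flat. A row killed by the cokernel lies in the row
    space. *)
Lemma dual_frame k (bs : k.-tuple 'I_n) : independent bs ->
  exists (w : 'I_k -> 'rV[K]_l) (P : seq 'rV[K]_l),
  [/\ forall a b, A (tnth bs a) (w b) = (a == b)%:R,
      forall a p, p \in P -> A (tnth bs a) p = 0
    & forall j, (forall p, p \in P -> A j p = 0) ->
        exists c : 'I_k -> K, A j = \sum_a c a *: A (tnth bs a)].
Proof.
move=> ind; pose B : 'M[K]_(k, l) := \matrix_a form_row (tnth bs a).
have rowE a (C : 'cV[K]_l) : (form_row (tnth bs a) *m C) 0 0 = (B *m C) a 0.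
  by rewrite !mxE; apply: eq_bigr => b _; rewrite !mxE.
have rowB (u : 'rV[K]_k) v :
    (u *m B *m v^T) 0 0 = \sum_a u 0 a * (A (tnth bs a) v : K).
  rewrite -mulmxA mxE; apply: eq_bigr => a _; congr (_ * _).
  by rewrite form_rowE rowE.
have freeB : row_free B.
  apply: inj_row_free => u uB; apply/rowP => a; rewrite mxE.
  apply: (ind (fun a => u 0 a)); apply/lfunP => v.
  rewrite zero_lfunE sum_lfunE; under eq_bigr do rewrite scale_lfunE.
  by rewrite -rowB uB mul0mx mxE.
have [W BW] := row_freeP freeB.
exists (fun b => (col b W)^T), [seq (col b (cokermx B))^T | b <- enum 'I_l].
split.
- by move=> a b; rewrite form_rowE trmxK rowE mulmx_col BW !mxE.
- move=> a _ /mapP[b _ ->]; rewrite form_rowE trmxK rowE mulmx_col mulmx_coker.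
  by rewrite !mxE.
move=> j Aj.
have : (form_row j <= B)%MS.
  rewrite submxE; apply/eqP/rowP => b; rewrite [RHS]mxE.
  have -> : (form_row j *m cokermx B) 0 b = A j (col b (cokermx B))^T.
    by rewrite form_rowE trmxK mulmx_col [RHS]mxE.
  by rewrite Aj //; apply/mapP; exists b => //; rewrite mem_enum.
move=> /submxP[u uB]; exists (fun a => u 0 a); apply/lfunP => v.
rewrite form_rowE uB rowB sum_lfunE; apply: eq_bigr => a _.
by rewrite scale_lfunE.
Qed.

(* lev j is the first nonzero coordinate of A j in the basis bs (None outside
   the span of bs): the points v e are perturbations, with signs e, of a generic
   point of the flat of bs along the dual basis of bs, the a-th direction being
   infinitely larger than the next one, so that the sign of A j at v e depends
   on the coordinate lev j of e only. *)
Lemma flag_points k (bs : k.-tuple 'I_n) : independent bs ->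
  exists (lev : 'I_n -> option 'I_k) (s : 'I_n -> bool)
    (v : {ffun 'I_k -> bool} -> 'rV[K]_l),
  [/\ forall e j, (A j (v e) : K) != 0,
      forall e j, (0 < (A j (v e) : K)) = s j (+) oapp e false (lev j),
      forall j, lev j != None ->
        exists c : 'I_k -> K, A j = \sum_a c a *: A (tnth bs a)
    & forall j (c : 'I_k -> K), A j = \sum_a c a *: A (tnth bs a) ->
        exists m, [/\ lev j = Some m, forall a : 'I_k, (a < m)%N -> c a = 0,
                      c m != 0 & s j = (0 < c m)]].
Proof.
move=> /dual_frame[w [P [wE PE spanE]]].
have coordE j (c : 'I_k -> K) : A j = \sum_a c a *: A (tnth bs a) ->
    (forall b, A j (w b) = c b) /\ (forall p, p \in P -> A j p = 0).
  move=> Aj; split=> [b|p pP]; rewrite Aj sum_lfunE.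
    rewrite (bigD1 b) //= scale_lfunE wE eqxx big1 ?addr0 /= => [|a ab].
      exact: mulr1.
    by rewrite scale_lfunE wE (negbTE ab) scaler0.
  by rewrite big1 // => a _; rewrite scale_lfunE PE // scaler0.
pose ws (e : {ffun 'I_k -> bool}) := P ++ [seq (-1) ^+ e b *: w b | b <- enum 'I_k].
have [v vE] := @fin_all_exists {ffun 'I_k -> bool} (fun=> 'rV[K]_l) _
  (fun e => lex_point (ws e)).
suff /fin_all_exists[ls lsE] : forall j, exists ls : option 'I_k * bool,
  [/\ forall e, (A j (v e) : K) != 0,
      forall e, (0 < (A j (v e) : K)) = ls.2 (+) oapp e false ls.1,
      ls.1 != None ->
        exists c : 'I_k -> K, A j = \sum_a c a *: A (tnth bs a)
    & forall (c : 'I_k -> K), A j = \sum_a c a *: A (tnth bs a) ->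
        exists m, [/\ ls.1 = Some m, forall a : 'I_k, (a < m)%N -> c a = 0,
                      c m != 0 & ls.2 = (0 < c m)]].
  exists (fun j => (ls j).1), (fun j => (ls j).2), v.
  by split=> [e j|e j|j|j]; case: (lsE j).
(* A form nonzero somewhere on [P] has its sign fixed there, independently of [e], because [P]
   precedes the dual vectors in [ws]. Any other form lies in the span. *)
move=> j; have [hP|/hasPn noP] := boolP (has (fun p => (A j p : K) != 0) P).
  have leadE e : lead_value (ws e) j = lead_value P j.
    by rewrite /lead_value /ws find_cat hP nth_cat -has_find hP.
  have lead0 : lead_value P j != 0 by exact: (nth_find 0 hP).
  exists (None, 0 < lead_value P j); split=> //= [e|e|c /coordE[_ Pc]].
  - by rewrite -sgr_eq0 vE leadE sgr_eq0.
  - by rewrite addbF -sgr_gt0 vE leadE sgr_gt0.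
  - by have /hasP[p /Pc ->] := hP; rewrite eqxx.
have [c Ac] := spanE j (fun p pP => eqP (negPn (noP p pP))).
have [wc _] := coordE j c Ac.
pose q b := c b != 0.
have hasq : has q (enum 'I_k).
  apply: contraT => /hasPn allc; have := form_neq0 A j.
  rewrite Ac big1 ?eqxx // => a _.
  by have := allc a (mem_enum _ a); rewrite negbK => /eqP ->; rewrite scale0r.
have [m0 _ _] := hasP hasq.
pose m := nth m0 (enum 'I_k) (find q (enum 'I_k)).
have cm : c m != 0 by exact: (nth_find m0 hasq).
have valm : val m = find q (enum 'I_k).
  by rewrite /= nth_enum_ord // -[X in (_ < X)%N]size_enum_ord -has_find.
have leadE e : lead_value (ws e) j = (-1) ^+ e m * c m.
  rewrite /lead_value /ws find_cat ifN; last by apply/hasPn.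
  rewrite find_map (@eq_find _ _ q) => [|b /=]; last first.
    by rewrite linearZ /= wc mulf_eq0 signr_eq0.
  rewrite nth_cat ltnNge leq_addr /= addKn (nth_map m0) ?linearZ /= ?wc //.
  by rewrite -has_find.
exists (Some m, 0 < c m); split=> //= [e|e|_|c' /coordE[wc' _]].
- by rewrite -sgr_eq0 vE leadE sgr_eq0 mulf_neq0 // signr_eq0.
- rewrite -sgr_gt0 vE leadE sgr_gt0; case: (e m); last by rewrite mul1r addbF.
  by rewrite mulN1r oppr_gt0 addbT -leNgt le_eqVlt (negbTE cm).
- by exists c.
have cc' b : c' b = c b by rewrite -wc' wc.
exists m; split; rewrite ?cc' // => a am; rewrite cc'.
apply/eqP/negbFE; have := @before_find _ m0 q (enum 'I_k) a.
by rewrite nth_ord_enum -valm; apply.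
Qed.

End Frame.

(** * Monomials in Heaviside functions and the filtration *)

Section Monomials.
Variables (R : idomainType) (K : realType) (l n : nat) (A : arrangement K l n).

Definition hmono (t : seq 'I_n) : VG R A := \prod_(j <- t) @heaviside R K l n A j.

Lemma VG_prodE (I : Type) (r : seq I) (P : pred I) (F : I -> VG R A) C :
  (\prod_(i <- r | P i) F i) C = \prod_(i <- r | P i) F i C.
Proof. by elim/big_rec2: _ => // i y f _ <-. Qed.

Lemma VG_sumE (I : Type) (r : seq I) (P : pred I) (F : I -> VG R A) C :
  (\sum_(i <- r | P i) F i) C = \sum_(i <- r | P i) F i C.
Proof. by elim/big_rec2: _ => // i y f _ <-. Qed.

Lemma hmono_chamber_of (t : seq 'I_n) v (gv : generic_point A v) :
  hmono t (chamber_of gv) = (all (fun j => 0 < (A j v : K)) t)%:R.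
Proof.
rewrite /hmono VG_prodE; elim: t => [|j t IHt]; first by rewrite big_nil.
rewrite big_cons IHt heaviside_chamber_of /=.
by case: (0 < _) => /=; rewrite ?mul1r ?mul0r.
Qed.

Lemma Fil_pred_le (i j : int) (f : VG R A) :
  i <= j -> f \in Fil_pred i -> f \in Fil_pred j.
Proof.
case: i => [i|i] ij; last by move=> /asboolP /= ->; rewrite rpred0.
case: j ij => // j ij /asboolP[G dG ->]; apply/asboolP; exists G => //.
exact: leq_trans dG _.
Qed.

Lemma heaviside_Fil j : @heaviside R K l n A j \in Fil_pred 1.
Proof.
apply/asboolP; exists (mpoly.mpolyX R (mpoly.mnm1 j)).
  by rewrite mpoly.msizeX mpoly.mdeg1.
by apply/funext => C; rewrite /poly_heaviside mpoly.mevalXU.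
Qed.

Lemma one_Fil : (1 : VG R A) \in Fil_pred 0.
Proof. exact: filVG_one_subproof. Qed.

Lemma prod_Fil (I : Type) (t : seq I) (P : pred I) (F : I -> VG R A) :
  (forall i, F i \in Fil_pred 1) ->
  \prod_(i <- t | P i) F i \in Fil_pred (count P t)%:Z.
Proof.
move=> F1; elim: t => [|i t IHt]; first by rewrite big_nil one_Fil.
rewrite big_cons /=; case: ifP => _; last by rewrite add0n.
by rewrite PoszD; exact: Fil_mul.
Qed.

Lemma hmono_Fil t : hmono t \in Fil_pred (size t)%:Z.
Proof.
by rewrite -(count_predT t); apply: prod_Fil => j; exact: heaviside_Fil.
Qed.

Lemma Fil_span d (f : VG R A) : f \in Fil_pred d%:Z ->
  exists ts : seq (R * seq 'I_n),
    (forall t, t \in ts -> (size t.2 <= d)%N) /\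
    f = \sum_(t <- ts) t.1 *: hmono t.2.
Proof.
move=> /asboolP[G dG ->].
pose expand (m : mpoly.multinom n) : seq 'I_n :=
  flatten [seq nseq (mpoly.fun_of_multinom m i) i | i <- index_enum 'I_n].
exists [seq (mpoly.mcoeff m G, expand m) | m <- mpoly.msupp G]; split.
  move=> _ /mapP[m mG ->] /=; rewrite -ltnS.
  apply: leq_trans dG; suff -> : size (expand m) = mpoly.mdeg m.
    exact: mpoly.msize_mdeg_lt.
  rewrite size_flatten /shape -map_comp mpoly.mdegE sumnE big_map.
  by apply: eq_bigr => i _ /=; rewrite size_nseq.
apply/funext => C; rewrite /poly_heaviside mpoly.mevalE VG_sumE [in RHS]big_map.
elim: (mpoly.msupp G) => [|m r IHr]; first by rewrite !big_nil.
rewrite !big_cons IHr; congr (_ * _ + _).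
rewrite /hmono VG_prodE /expand big_flatten big_map.
apply: eq_bigr => i _; rewrite big_nseq.
by elim: (mpoly.fun_of_multinom m i) => //= p <-; rewrite exprS.
Qed.

End Monomials.

(** * Residues: alternating sums of values near a flat *)

Section Residue.
Variables (R : idomainType) (K : realType) (l n : nat) (A : arrangement K l n).
Variables (k : nat) (v : {ffun 'I_k -> bool} -> 'rV[K]_l).
Hypothesis gv : forall e, generic_point A (v e).

(** An iterated difference: in each direction [a], the value at [e a] false minus the value at [e a]
    true. *)
Definition residue (f : VG R A) : R^o :=
  \sum_(e : {ffun 'I_k -> bool}) (\prod_a (-1) ^+ e a) * (f (chamber_of (gv e)) : R).

Fact residue_is_linear : linear residue.
Proof.
move=> c f g; rewrite /residue scaler_sumr -big_split /=; apply: eq_bigr => e _.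
have distr (p x y : R) : p * (c * x + y) = c * (p * x) + p * y.
  by rewrite mulrDr mulrCA.
exact: distr.
Qed.
HB.instance Definition _ :=
  GRing.isLinear.Build R (VG R A) R^o *:%R residue residue_is_linear.

Hypothesis char2 : 2%N \notin [pchar R].
Variables (lev : 'I_n -> option 'I_k) (s : 'I_n -> bool).
Hypothesis levE : forall e j, (0 < (A j (v e) : K)) = s j (+) oapp e false (lev j).

(* Flipping the coordinate m of e changes the sign of each term. *)
Lemma residue_missing (t : seq 'I_n) m :
  m \notin pmap lev t -> residue (hmono R t) = 0.
Proof.
move=> mt; pose flip (e : {ffun 'I_k -> bool}) := [ffun a => (a == m) (+) e a].
have flipK : involutive flip by move=> e; apply/ffunP => a; rewrite !ffunE addKb.
have resN : residue (hmono R t) = - residue (hmono R t).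
  rewrite {1}/residue (reindex_inj (inv_inj flipK)) -sumrN /=.
  apply: eq_bigr => e _; rewrite -mulNr; congr (_ * _); last first.
    rewrite !hmono_chamber_of; congr (_ _); congr (nat_of_bool _).
    apply: eq_in_all => j jt; rewrite !levE; case levj : (lev j) => [a|] //=.
    rewrite ffunE (_ : (a == m) = false) //; apply: contraNF mt => /eqP <-.
    by rewrite mem_pmap -levj map_f.
  rewrite (bigD1 m) // [in RHS](bigD1 m) //= -mulNr; congr (_ * _).
    by rewrite ffunE eqxx; case: (e m); rewrite ?opprK.
  by apply: eq_bigr => a am; rewrite ffunE (negbTE am).
(* The residue equals its opposite, so twice it is 0, and 2 is nonzero in the domain [R]. *)
apply/eqP; move: char2; rewrite inE /= => two0.
move/eqP: resN; rewrite -subr_eq0 opprK -mulr2n -mulr_natl mulf_eq0.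
by rewrite (negbTE two0).
Qed.

(** A monomial with fewer than [k] factors misses one of the [k] levels. For [k = 0] the lower step
    is [Fil (-1)], which is zero. *)
Lemma residue_Fil (f : VG R A) : f \in Fil_pred (k%:Z - 1) -> residue f = 0.
Proof.
have [k0|k_gt0] := posnP k.
  by rewrite {1}k0 => /asboolP ->; rewrite linear0.
have [k' kE] : exists k', k = k'.+1 by exists k.-1; rewrite prednK.
rewrite {1}kE -addn1 PoszD addrK => /Fil_span[ts [ts_le ->]].
rewrite linear_sum big_seq big1 // => t /ts_le tk; rewrite linearZ /=.
have [m mt] : exists m, m \notin pmap lev t.2.
  apply/existsP; apply: contraT; rewrite negb_exists => /forallP allt.
  have := uniq_leq_size (enum_uniq 'I_k) (s2 := pmap lev t.2) _.
  move=> /(_ (fun a _ => negPn (allt a))); rewrite size_enum_ord leqNgt.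
  have -> // : (size (pmap lev t.2) < k)%N.
  rewrite [ltnRHS]kE ltnS (leq_trans _ tk) // size_pmap.
  exact: count_size.
by rewrite (residue_missing mt) scaler0.
Qed.

(** All [k] factors are positive at a single [e], namely [e a = ~~ s (tnth t a)], so one term of the
    sum survives. *)
Lemma residue_hmono (t : k.-tuple 'I_n) :
  (forall a, lev (tnth t a) = Some a) ->
  residue (hmono R t) = (\prod_a (-1) ^+ (~~ s (tnth t a) : bool) : R).
Proof.
move=> levt; rewrite /residue.
rewrite (bigD1 [ffun a => ~~ s (tnth t a)]) //= [X in _ + X]big1 ?addr0 => [|e ne].
  rewrite hmono_chamber_of (_ : all _ _) ?mulr1.
    by apply: eq_bigr => a _; rewrite ffunE.
  by apply/all_tnthP => a; rewrite levE levt /= ffunE; case: (s _).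
rewrite hmono_chamber_of (_ : all _ _ = false) ?mulr0 //.
apply: contraNF ne => /all_tnthP allt; apply/eqP/ffunP => a.
by have := allt a; rewrite levE levt /= ffunE; case: (s _); case: (e a).
Qed.

End Residue.

Section ResidueFunctional.
Variables (R : idomainType) (K : realType) (l n : nat) (A : arrangement K l n).
Hypothesis char2 : 2%N \notin [pchar R].

(** Hides the sample points: later arguments use only the functional, the levels and the signs. *)
Lemma residue_functional k (bs : k.-tuple 'I_n) : independent A bs ->
  exists (L : {linear VG R A -> R^o}) (lev : 'I_n -> option 'I_k) (s : 'I_n -> bool),
  [/\ forall f, f \in Fil_pred (k%:Z - 1) -> L f = 0,
      forall t m, m \notin pmap lev t -> L (hmono R t) = 0,
      forall t : k.-tuple 'I_n, (forall a, lev (tnth t a) = Some a) ->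
        L (hmono R t) = (\prod_a (-1) ^+ (~~ s (tnth t a) : bool) : R),
      forall j, lev j != None ->
        exists c : 'I_k -> K, A j = \sum_a c a *: A (tnth bs a)
    & forall j (c : 'I_k -> K), A j = \sum_a c a *: A (tnth bs a) ->
        exists m, [/\ lev j = Some m, forall a : 'I_k, (a < m)%N -> c a = 0,
                      c m != 0 & s j = (0 < c m)]].
Proof.
move=> /flag_points[lev [s [v [v0 levE levN levS]]]].
have gv e : generic_point A (v e) by exact: v0.
exists (residue gv : {linear VG R A -> R^o}), lev, s; split=> //.
- exact: residue_Fil levE.
- exact: residue_missing levE.
- exact: residue_hmono levE.
Qed.

Lemma basis_level k (bs : k.-tuple 'I_n) (lev : 'I_n -> option 'I_k) (s : 'I_n -> bool) :
  (forall j (c : 'I_k -> K), A j = \sum_a c a *: A (tnth bs a) ->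
     exists m, [/\ lev j = Some m, forall a : 'I_k, (a < m)%N -> c a = 0,
                   c m != 0 & s j = (0 < c m)]) ->
  forall a, lev (tnth bs a) = Some a /\ s (tnth bs a).
Proof.
move=> levS a; have [|m [levm _ cm sm]] := levS (tnth bs a) (fun b => (b == a)%:R).
  rewrite (bigD1 a) //= eqxx scale1r big1 ?addr0 // => b /negbTE ->.
  by rewrite scale0r.
have ma : m = a by apply/eqP; apply: contraNT cm => /negbTE ->.
by rewrite levm sm ma eqxx ltr01.
Qed.

Lemma residue_basis k (bs : k.-tuple 'I_n) : independent A bs ->
  exists L : {linear VG R A -> R^o},
    (forall f, f \in Fil_pred (k%:Z - 1) -> L f = 0) /\ L (hmono R bs) = 1.
Proof.
move=> /residue_functional[L [lev [s [LFil _ Lt _ levS]]]]; exists L; split=> //.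
have levb := basis_level levS.
rewrite Lt => [|a]; last by have [] := levb a.
by apply: big1 => a _; have [_ ->] := levb a.
Qed.

End ResidueFunctional.

(** * Relations in the algebra coming from linear relations among forms *)

Lemma prod_shift_step (T : comPzRingType) (z a Pa P S : T) :
  (z + a) * Pa - z * P - (a * P + z * S) = a * S + (z + a) * (Pa - P - S).
Proof. by ring. Qed.

(** Up to the sign [(-1) ^+ b], the expression is the indicator of [(-1) ^+ b * (x * y) > 0], the
    value of one factor in [relation_product]. *)
Lemma signed_indicator_neq0 (R : nzRingType) (K : realDomainType) (b : bool) (x y : K) :
  x != 0 -> y != 0 ->
  (-1) ^+ (x < 0)%R * (0 < y)%R%:R + ((x < 0)%R%:R - b%:R) != 0 :> R ->
  0 < (-1) ^+ b * (x * y).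
Proof.
case: (ltgtP x 0) => // x0 _; case: (ltgtP y 0) => // y0 _; case: b => /=;
  rewrite ?(mulr0, mulr1, mul1r, subr0, addr0, add0r, sub0r, addNr, subrr, eqxx) // => _;
  by rewrite ?expr0 ?expr1 ?mul1r ?mulN1r ?oppr_gt0; nra.
Qed.

Section Relation.
Variables (R : idomainType) (K : realType) (l n : nat) (A : arrangement K l n).

Definition const_VG (a : R) : VG R A := fun=> a.

Lemma scale_VG a (f : VG R A) : a *: f = const_VG a * f.
Proof. exact/funext. Qed.

Lemma const_Fil a : const_VG a \in Fil_pred 0.
Proof. by rewrite -[const_VG a]mulr1 -scale_VG rpredZ // one_Fil. Qed.

(** First-order expansion of the product: each remaining term uses at least two of the constants
    [a j], hence at most [size js - 2] factors of degree one. *)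
Lemma prod_shift_Fil (z a : 'I_n -> VG R A) (js : seq 'I_n) :
  (forall j, z j \in Fil_pred 1) -> (forall j, a j \in Fil_pred 0) -> uniq js ->
  \prod_(j <- js) (z j + a j) - \prod_(j <- js) z j
    - \sum_(i <- js) a i * \prod_(j <- js | j != i) z j
  \in Fil_pred ((size js)%:Z - 2).
Proof.
move=> z1 a0; elim: js => [_|i js IHjs]; first by rewrite !big_nil subrr subr0 rpred0.
rewrite cons_uniq => /andP[ijs ujs]; have {IHjs} := IHjs ujs.
set P := \prod_(j <- js) z j; set Pa := \prod_(j <- js) _.
set S := \sum_(i <- js) _; set E := Pa - P - S => E_Fil.
rewrite !big_cons eqxx /= -/P -/Pa.
have -> : \prod_(j <- js | j != i) z j = P.
  rewrite /P [RHS]big_seq_cond [LHS]big_seq_cond; apply: eq_bigl => j.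
  by rewrite andbT; case: (boolP (j \in js)) => //= jjs; apply: contraNneq ijs => <-.
have -> : \sum_(i0 <- js) a i0 * \prod_(j <- i :: js | j != i0) z j = z i * S.
  rewrite /S mulr_sumr [LHS]big_seq_cond [RHS]big_seq_cond.
  apply: eq_bigr => j /andP[jjs _]; rewrite big_cons ifT ?(mulrCA (a j)) //.
  by apply: contraNneq ijs => ->.
have S_Fil : S \in Fil_pred ((size js)%:Z - 1).
  rewrite /S big_seq rpred_sum // => j jjs.
  rewrite -[(size js)%:Z - 1]add0r Fil_mul //.
  apply: Fil_pred_le (prod_Fil js (fun k => k != j) z1).
  rewrite -(count_predC (pred1 j) js) PoszD [X in _ <= X - 1]addrC -addrA lerDl subr_ge0.
  by rewrite lez_nat -has_count has_pred1.
(* The error for the longer list is [a i * S + (z i + a i) * E]; both summands lie in the step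
   [size js - 1]. *)
rewrite (prod_shift_step (z i) (a i) Pa P S) -/E.
have -> : (size js).+1%:Z - 2 = (size js)%:Z - 1 by rewrite -addn1 PoszD -addrA.
have zai : z i + a i \in Fil_pred 1 by rewrite rpredD // (Fil_pred_le _ (a0 i)).
rewrite rpredD //; first by rewrite -[_ - 1]add0r Fil_mul.
by rewrite (_ : _ - 1 = 1 + ((size js)%:Z - 2)) ?Fil_mul // addrCA.
Qed.

Lemma prod_scale (c : 'I_n -> R) (f : 'I_n -> VG R A) (t : seq 'I_n) (P : pred 'I_n) :
  \prod_(j <- t | P j) (c j *: f j) =
  (\prod_(j <- t | P j) c j) *: \prod_(j <- t | P j) f j.
Proof.
elim/big_rec3: _ => [|j f' c' fc' _ ->]; first by rewrite scale1r.
by apply/funext => C; exact: mulrACA.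
Qed.

Variables (lam : 'I_n -> K) (js : seq 'I_n).
Hypothesis js_uniq : uniq js.
Hypothesis jsE : forall i, (i \in js) = (lam i != 0).
Hypothesis js_neq0 : (0 < size js)%N.
Hypothesis lam_rel : \sum_i lam i *: A i = 0.

(* For b = false the i-th factor is the Heaviside function of lam i * alpha i,
   for b = true it is minus that of - lam i * alpha i; the forms lam i * alpha i
   sum to 0, so on no chamber do they all have the same sign. *)
Lemma relation_product (b : bool) :
  \prod_(i <- js) ((-1) ^+ (lam i < 0)%R *: @heaviside R K l n A i
     + const_VG ((lam i < 0)%R%:R - b%:R)) = 0.
Proof.
apply/funext => C; have [v [gv ->]] := chamber_surj C.
rewrite VG_prodE; apply/eqP; apply: contraT.
rewrite -[0 _]/(0 : R) prodf_seq_neq0 => /allP /= nz.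
have sumv : \sum_(i <- js) lam i * (A i v : K) = 0.
  have lam0 : \sum_i lam i * (A i v : K) = 0.
    rewrite -[0 in RHS](@zero_lfunE _ 'rV[K]_l K^o v) -lam_rel sum_lfunE.
    by under [RHS]eq_bigr do rewrite scale_lfunE.
  rewrite -[RHS]lam0 big_uniq //= big_mkcond /=; apply: eq_bigr => i _.
  by rewrite jsE; case: eqP => //= ->; rewrite mul0r.
have signv i : i \in js -> 0 < (-1) ^+ b * (lam i * (A i v : K)).
  move=> ijs; have := nz i ijs; move: ijs (gv i); rewrite jsE.
  rewrite -[(_ + _) _]/((-1) ^+ (lam i < 0)%R * heaviside R i (chamber_of gv)
    + ((lam i < 0)%R%:R - b%:R)) heaviside_chamber_of.
  exact: signed_indicator_neq0.
have : 0 < \sum_(i <- js) (-1) ^+ b * (lam i * (A i v : K)).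
  case: js js_neq0 signv => // i t _ sg; rewrite big_cons ltr_pwDl //.
    by rewrite sg // mem_head.
  by rewrite big_seq sumr_ge0 // => j jt; rewrite ltW // sg // inE jt orbT.
by rewrite -mulr_sumr sumv mulr0 ltxx.
Qed.

Let sg i : R := (-1) ^+ (lam i < 0)%R.
Let z i : VG R A := sg i *: @heaviside R K l n A i.
Let a (b : bool) i : VG R A := const_VG ((lam i < 0)%R%:R - b%:R).

Let z_Fil i : z i \in Fil_pred 1.
Proof. by rewrite rpredZ // heaviside_Fil. Qed.

Let shift_Fil b :
  \prod_(j <- js) z j + \sum_(i <- js) a b i * \prod_(j <- js | j != i) z j
  \in Fil_pred ((size js)%:Z - 2).
Proof.
have := @prod_shift_Fil z (a b) js z_Fil (fun i => const_Fil _) js_uniq.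
by rewrite [X in X - _ - _]relation_product sub0r -opprD rpredN.
Qed.

Let sg2 i : sg i * sg i = 1.
Proof. by rewrite /sg -signr_addb addbb. Qed.

Let prod_sg2 : (\prod_(i <- js) sg i) * (\prod_(i <- js) sg i) = 1.
Proof. by rewrite -big_split big1 //= => i _; exact: sg2. Qed.

(** The full product in [relation_product] is 0, so its expansion for [b] false rewrites the top
    product, modulo lower terms, by products with one factor omitted. *)
Lemma relation_hmono_Fil : hmono R js \in @Fil_pred R K l n A ((size js)%:Z - 1).
Proof.
have -> : hmono R js = (\prod_(i <- js) sg i) *: \prod_(i <- js) z i.
  by rewrite prod_scale scalerA prod_sg2 scale1r.
rewrite rpredZ // -[X in X \in _](addrK (\sum_(i <- js) a false i * \prod_(j <- js | j != i) z j)).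
rewrite rpredB //; first by apply: Fil_pred_le (shift_Fil false); rewrite lerD2l.
rewrite big_seq rpred_sum // => j jjs.
rewrite -[(size js)%:Z - 1]add0r Fil_mul ?const_Fil //.
apply: Fil_pred_le (prod_Fil js (fun k => k != j) z_Fil).
rewrite -(count_predC (pred1 j) js) PoszD [X in _ <= X - 1]addrC -addrA lerDl subr_ge0.
by rewrite lez_nat -has_count has_pred1.
Qed.

(** The expansions for the two values of [b] share their top product, and
    [a false i - a true i = 1]; subtracting them leaves the products with one factor omitted. *)
Lemma relation_derivative_Fil :
  \sum_(i <- js) sg i *: @hmono R K l n A [seq j <- js | j != i]
  \in Fil_pred ((size js)%:Z - 2).
Proof.
have := rpredB (shift_Fil false) (shift_Fil true).
rewrite opprD addrACA subrr add0r -sumrB.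
(* Multiplying by all signs [sg j] cancels those with [j != i] and leaves [sg i]. *)
move=> /(rpredZ (\prod_(i <- js) sg i)); rewrite scaler_sumr.
suff -> : \sum_(i <- js) (\prod_(i <- js) sg i) *:
    (a false i * \prod_(j <- js | j != i) z j - a true i * \prod_(j <- js | j != i) z j) =
  \sum_(i <- js) sg i *: @hmono R K l n A [seq j <- js | j != i] by [].
rewrite big_seq [RHS]big_seq; apply: eq_bigr => i ijs.
rewrite -mulrBl (_ : a false i - a true i = 1) ?mul1r; last first.
  by apply/funext => C; rewrite /a /const_VG /= -[LHS]/(_ - _ : R) subr0 opprB addrCA subrr addr0.
rewrite prod_scale scalerA /hmono big_filter; congr (_ *: _).
rewrite (bigD1_seq i) //= -mulrA -big_split /= big1 ?mulr1 // => j _; exact: sg2.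
Qed.

End Relation.

(** * Classes in the graded algebra *)

Section GradedClass.
Variables (R : idomainType) (K : realType) (l n : nat) (A : arrangement K l n).

(* Junk value: cls k f = 0 when f is not in Fil k. *)
Definition cls k (f : VG R A) : grVG R A k := gr_class (insubd (0 : filVG R A k) f).

Lemma cls_gr_class k (f : filVG R A k) : cls k (val f) = gr_class f.
Proof. by rewrite /cls valKd. Qed.

Lemma cls_surj k (x : grVG R A k) : exists2 f, f \in Fil_pred k & x = cls k f.
Proof.
exists (val (repr x)); first exact: valP.
by rewrite cls_gr_class /gr_class; exact/esym/(@reprK _ (grVG R A k)).
Qed.

Lemma cls_linear k (a : R) (f g : VG R A) : f \in Fil_pred k%:Z -> g \in Fil_pred k%:Z ->
  cls k (a *: f + g) = a *: cls k f + cls k g.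
Proof.
move=> Ff Fg.
have -> : a *: f + g = val (a *: FilVG Ff + FilVG Fg) by rewrite linearP.
rewrite cls_gr_class -[f in RHS]/(val (FilVG Ff)) -[g in RHS]/(val (FilVG Fg)).
rewrite !cls_gr_class -[RHS]/(lquot_scale a (gr_class _) + gr_class _) /gr_class.
by rewrite (pi_lquotZ _ a) -pi_lquotD.
Qed.

Lemma cls0 k : cls k 0 = 0.
Proof.
have := @cls_linear k (-1) 0 0 (rpred0 _) (rpred0 _).
by rewrite scaler0 addr0 scaleN1r addNr.
Qed.

Lemma clsZ k a (f : VG R A) : f \in Fil_pred k%:Z -> cls k (a *: f) = a *: cls k f.
Proof. by move=> Ff; have := cls_linear a Ff (rpred0 _); rewrite cls0 !addr0. Qed.

Lemma clsD k (f g : VG R A) : f \in Fil_pred k%:Z -> g \in Fil_pred k%:Z ->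
  cls k (f + g) = cls k f + cls k g.
Proof. by move=> Ff Fg; have := cls_linear 1 Ff Fg; rewrite !scale1r. Qed.

Lemma cls_sum k (I : eqType) (r : seq I) (c : I -> R) (F : I -> VG R A) :
  (forall i, i \in r -> F i \in Fil_pred k%:Z) ->
  cls k (\sum_(i <- r) c i *: F i) = \sum_(i <- r) c i *: cls k (F i).
Proof.
elim: r => [_|i r IHr rF]; first by rewrite !big_nil cls0.
have Fr j : j \in r -> F j \in Fil_pred k%:Z.
  by move=> jr; apply: rF; rewrite inE jr orbT.
rewrite !big_cons cls_linear ?IHr //; first by apply: rF; rewrite mem_head.
by rewrite big_seq rpred_sum // => j jr; rewrite rpredZ // Fr.
Qed.

Lemma cls_eq0 k (f : VG R A) : f \in Fil_pred k%:Z ->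
  (cls k f = 0) <-> (f \in Fil_pred (k%:Z - 1)).
Proof.
move=> Ff; rewrite -(cls0 k) /cls /gr_class.
have pr : reflect (cls k f = cls k 0)
    (insubd (0 : filVG R A k) f - insubd 0 0 \in @Fil_prev R K l n A k).
  exact: lquot_eqP.
have E : (insubd (0 : filVG R A k) f - insubd 0 0 \in @Fil_prev R K l n A k) =
   (f \in Fil_pred (k%:Z - 1)).
  change ((val (insubd (0 : filVG R A k) f - insubd (0 : filVG R A k) 0)
    \in Fil_pred (k%:Z - 1)) = (f \in Fil_pred (k%:Z - 1))).
  by rewrite raddfB /= !insubdK ?rpred0 // subr0.
by rewrite -E; split => /pr.
Qed.

Lemma cls_eq k (f g : VG R A) : f \in Fil_pred k%:Z -> g \in Fil_pred k%:Z ->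
  f - g \in Fil_pred (k%:Z - 1) -> cls k f = cls k g.
Proof.
move=> Ff Fg Ffg; apply/eqP; rewrite -subr_eq0 -scaleN1r addrC -cls_linear // scaleN1r addrC.
by apply/eqP/cls_eq0 => //; rewrite rpredB.
Qed.

Lemma cls_mul i j (f g : VG R A) : f \in Fil_pred i%:Z -> g \in Fil_pred j%:Z ->
  gr_mul (cls i f) (cls j g) = cls (i + j) (f * g).
Proof.
move=> Ff Fg; rewrite -[f]/(val (FilVG Ff)) -[g]/(val (FilVG Fg)).
by rewrite !cls_gr_class gr_mulE -cls_gr_class.
Qed.

Lemma cls_one : cls 0 1 = gr_one R A.
Proof. by rewrite -[1 in LHS]/(val (filVG_one R A)) cls_gr_class. Qed.

End GradedClass.

(** * Independence, circuits and flats of codimension two *)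

Section Independence.
Variables (K : realType) (l n : nat) (A : arrangement K l n).

Definition relation (lam : 'I_n -> K) := \sum_i lam i *: A i = 0.

Lemma sum_support (js : seq 'I_n) (lam : 'I_n -> K) :
  uniq js -> (forall i, i \notin js -> lam i = 0) ->
  \sum_i lam i *: A i = \sum_(i <- js) lam i *: A i.
Proof.
move=> ujs js0; rewrite [RHS]big_uniq //= [RHS]big_mkcond /=; apply: eq_bigr => i _.
by case: ifPn => // /js0 ->; rewrite scale0r.
Qed.

Lemma relation_eq0 k (bs : k.-tuple 'I_n) (lam : 'I_n -> K) :
  uniq bs -> independent A bs -> (forall i, i \notin bs -> lam i = 0) ->
  relation lam -> forall i, lam i = 0.
Proof.
move=> ubs ind bs0; rewrite /relation (sum_support ubs bs0) big_tuple => /ind lam0 i.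
case: (boolP (i \in bs)) => [/tnthP[a ->]|/bs0 //].
exact: lam0.
Qed.

Lemma independentI k (bs : k.-tuple 'I_n) : uniq bs ->
  (forall lam, (forall i, i \notin bs -> lam i = 0) -> relation lam ->
     forall i, lam i = 0) ->
  independent A bs.
Proof.
move=> ubs rel0 c sc a.
pose lam j := \sum_(b | tnth bs b == j) c b.
have lamE b : lam (tnth bs b) = c b.
  rewrite /lam (bigD1 b) //= big1 ?addr0 // => d /andP[/eqP /(tuple_uniqP _ ubs) -> ].
  by rewrite eqxx.
have supp i : i \notin bs -> lam i = 0.
  by move=> ibs; rewrite /lam big1 // => b /eqP bi; rewrite -bi mem_tnth in ibs.
rewrite -lamE rel0 // /relation (sum_support ubs supp) big_tuple -[RHS]sc.
by apply: eq_bigr => b _; rewrite lamE.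
Qed.

Lemma freeE k (bs : k.-tuple 'I_n) :
  reflect (independent A bs) (free [seq A i | i <- bs]).
Proof.
apply: (iffP (@freeP _ _ _ (map_tuple A bs))) => ind c sc a; apply: ind;
  rewrite -[RHS]sc; apply: eq_bigr => b _; congr (_ *: _);
  by rewrite -tnth_nth tnth_map.
Qed.

Lemma free_relation (J : {set 'I_n}) : reflect
  (exists lam, [/\ exists i, lam i != 0, forall i, i \notin J -> lam i = 0 & relation lam])
  (~~ free [seq A i | i in J]).
Proof.
have uJ : uniq (in_tuple (enum J)) by exact: enum_uniq.
apply: (iffP idP) => [|[lam [[i lami] J0 rel]]].
  move=> /negP nfree; apply: contrapT => norel; apply: nfree.
  apply/(freeE (in_tuple (enum J))); apply: independentI => // lam supp rel i.
  apply: contra_notP norel => li; exists lam; split=> //; first by exists i; exact/eqP.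
  by move=> j jJ; apply: supp; rewrite mem_enum.
apply/negP => /(freeE (in_tuple (enum J))) ind.
suff : lam i = 0 by move/eqP; rewrite (negbTE lami).
by apply: (relation_eq0 uJ ind) rel _ => j; rewrite mem_enum; exact: J0.
Qed.

Lemma circuit_support (J : {set 'I_n}) lam : circuit A J ->
  (exists i, lam i != 0) -> (forall i, i \notin J -> lam i = 0) -> relation lam ->
  forall i, (i \in J) = (lam i != 0).
Proof.
move=> /minsetP[_ minJ] nz J0 rel.
have <- : [set i | lam i != 0]%SET = J; last by move=> i; rewrite inE.
apply: minJ.
  by apply/free_relation; exists lam; split=> // i; rewrite inE negbK => /eqP.
by apply/fintype.subsetP => i; rewrite inE; apply: contraR => /J0 ->.
Qed.

Lemma circuit_relation (J : {set 'I_n}) : circuit A J ->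
  exists2 lam, relation lam & forall i, (i \in J) = (lam i != 0).
Proof.
move=> cJ; have /minsetP[/free_relation[lam [nz J0 rel]] _] := cJ.
by exists lam => //; exact: circuit_support.
Qed.

Lemma circuit_neq0 J : circuit A J -> (0 < #|J|)%N.
Proof.
move=> /minsetP[/free_relation[lam [[i lami] J0 _]] _].
by apply/card_gt0P; exists i; apply: contraNT lami => /J0 ->.
Qed.

Lemma form_scale_inj i j (c : K) : A i = c *: A j -> i = j.
Proof.
move=> Aij; have c0 : c != 0.
  by apply: contraNneq (form_neq0 A i) => c0; rewrite Aij c0 scale0r.
apply: (@form_distinct _ _ _ A); apply/vspaceP => v.
by rewrite !memv_ker Aij scale_lfunE scaler_eq0 (negbTE c0).
Qed.

Lemma independent1 j : independent A [tuple j].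
Proof.
move=> c; rewrite big_ord1 tnth0 => /eqP; rewrite scaler_eq0 (negbTE (form_neq0 A j)) orbF.
by move=> /eqP c0 a; rewrite (ord1 a).
Qed.

Lemma independent2 i j : i != j -> independent A [tuple i; j].
Proof.
move=> ij; apply: independentI => [|lam supp rel]; first by rewrite /= inE ij.
have ijs : uniq [:: i; j] by rewrite /= inE ij.
move: rel; rewrite /relation (sum_support ijs supp) !big_cons big_nil addr0 => rel.
have lami : lam i = 0.
  apply: contraNeq ij => li; apply/eqP/(@form_scale_inj _ _ (- (lam i)^-1 * lam j)).
  rewrite -scalerA -[A i]scale1r -(mulVf li) -scalerA scaleNr -scalerN; congr (_ *: _).
  by apply/eqP; rewrite -addr_eq0 rel.
move: rel; rewrite lami scale0r add0r => /eqP.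
rewrite scaler_eq0 (negbTE (form_neq0 A j)) orbF => /eqP lamj h.
have [->//|hi] := eqVneq h i; have [->//|hj] := eqVneq h j.
by rewrite supp // !inE negb_or hi hj.
Qed.

Lemma dim_img_form i (U : {vspace 'rV[K]_l}) v :
  v \in U -> A i v != 0 -> \dim (A i @: U) = 1%N.
Proof.
move=> Uv Aiv; apply/eqP; rewrite eqn_leq; apply/andP; split.
  by rewrite (leq_trans (dimvS (subvf _))) // dimvf.
rewrite lt0n dimv_eq0; apply: contraNneq Aiv => U0.
by rewrite -memv0 -U0 memv_img.
Qed.

Lemma dim_hyperplane i : (\dim (hyperplane A i) + 1 = l)%N.
Proof.
have [v Aiv] : exists v, A i v != 0.
  apply: contrapT => /forallNP A0; have /eqP := form_neq0 A i; apply.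
  by apply/lfunP => v; rewrite zero_lfunE; apply/eqP/negPn/negP/A0.
have := limg_ker_dim (A i) fullv.
by rewrite capfv (dim_img_form (memvf v) Aiv) dimvf /dim /= mul1n.
Qed.

(** By distinctness [A j] does not vanish on the hyperplane of [i], so intersecting lowers the
    dimension once more. *)
Lemma dim_hyperplane2 i j : i != j ->
  (\dim (hyperplane A i :&: hyperplane A j) + 2 = l)%N.
Proof.
move=> ij; have [v vi Ajv] : exists2 v, v \in hyperplane A i & A j v != 0.
  apply: contrapT => /forall2NP A0; move/eqP: ij; apply.
  apply: (@form_distinct _ _ _ A); apply/eqP.
  rewrite eqEdim -(leq_add2r 1) !dim_hyperplane leqnn andbT.
  apply/subvP => v vi; rewrite memv_ker; apply/negPn/negP => Ajv.
  by case: (A0 v).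
rewrite -[2%N]/(1 + 1)%N addnA -[X in (_ + X + _)%N](dim_img_form vi Ajv).
by rewrite limg_ker_dim dim_hyperplane.
Qed.

(** A form in the span of [A i] and [A j] vanishes on their common flat, which has codimension 2 and
    lies in no third hyperplane. *)
Lemma generic_pair i j h (c d : K) : generic_codim2 A -> i != j ->
  A h = c *: A i + d *: A j -> (h == i) || (h == j).
Proof.
move=> gen ij Ah.
have flatE : flat A [set i; j]%SET = (hyperplane A i :&: hyperplane A j)%VS.
  by rewrite /flat big_setU1 ?inE //= big_set1.
have := gen [set i; j]%SET; rewrite flatE => /(_ (dim_hyperplane2 ij)).
set S := [set _ | _]%SET => S2.
have ijS : [set i; j]%SET = S.
  apply/eqP; rewrite eqEcard S2 cards2 ij andbT; apply/fintype.subsetP => m.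
  by rewrite !inE => /orP[]/eqP ->; rewrite ?capvSl ?capvSr.
have : h \in S.
  rewrite inE; apply/subvP => v; rewrite memv_cap !memv_ker => /andP[/eqP vi /eqP vj].
  by rewrite Ah add_lfunE !scale_lfunE vi vj !scaler0 addr0.
by rewrite -ijS !inE.
Qed.

End Independence.

(** * Degrees one and two of the graded algebra *)

Section DegreeOneTwo.
Variables (R : idomainType) (K : realType) (l n : nat) (A : arrangement K l n).
Hypothesis char2 : 2%N \notin [pchar R].
Local Notation x := (@heaviside R K l n A).

Lemma hmono1 i : hmono R [:: i] = x i.
Proof. by rewrite /hmono big_seq1. Qed.

Lemma hmono2 i j : hmono R [:: i; j] = x i * x j.
Proof. by rewrite /hmono big_cons big_seq1. Qed.

(** The residue along [A j] reads off [a j]: no other form is proportional to [A j], so the other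
    indices have no level. *)
Lemma linear_Fil0 (a : 'I_n -> R) :
  \sum_i a i *: x i \in Fil_pred 0 -> forall i, a i = 0.
Proof.
move=> aF j; have [L [lev [s [LFil Lmiss Lt levN levS]]]] :=
  residue_functional char2 (@independent1 _ _ _ A j).
have [levj sj] := basis_level levS ord0.
have := LFil _ aF; rewrite linear_sum (bigD1 j) //= linearZ -hmono1.
rewrite -[[:: j]]/(tval [tuple j]) Lt => [|b]; last by rewrite (ord1 b).
rewrite big_ord1 sj expr0 big1 ?addr0 => [<-|i ij]; first by rewrite [RHS]mulr1.
have levi : lev i = None.
  apply/eqP/negPn/negP => /levN[c].
  by rewrite big_ord1 tnth0 => /form_scale_inj /eqP; rewrite (negbTE ij).
by rewrite linearZ /= -hmono1 (Lmiss _ ord0) ?scaler0 // mem_pmap inE levi.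
Qed.

(** By genericity only [i] and [j] have a level, so the residue along [A i, A j] kills every
    [x p * x q] except [x i * x j] and [x j * x i], where it is 1. The square has residue
    [2 * a i * a j]. *)
Lemma square_linear_Fil1 (a : 'I_n -> R) : generic_codim2 A ->
  (\sum_i a i *: x i) * (\sum_i a i *: x i) \in Fil_pred 1 ->
  forall i j, i != j -> a i * a j = 0.
Proof.
move=> gen aF i j ij; have [L [lev [s [LFil Lmiss Lt levN levS]]]] :=
  residue_functional char2 (independent2 (A := A) ij).
have levij := basis_level levS.
have levi : lev i = Some ord0 by case: (levij ord0).
have levj : lev j = Some ord_max by case: (levij ord_max).
have levO h : h != i -> h != j -> lev h = None.
  move=> hi hj; apply/eqP/negPn/negP => /levN[c].
  rewrite big_ord_recr big_ord1 /= => /(generic_pair gen ij).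
  by rewrite (negbTE hi) (negbTE hj).
pose c p q : R := L (hmono R [:: p; q]).
have Lij : c i j = 1.
  rewrite /c -[[:: _; _]]/(tval [tuple i; j]) Lt => [|b]; last by case: (levij b).
  by rewrite big1 // => b _; case: (levij b) => _ ->.
have Lji : c j i = 1 by rewrite -Lij /c !hmono2 mulrC.
have L0 p q : (p, q) != (i, j) -> (p, q) != (j, i) -> c p q = 0.
  move=> pqij pqji; have [m mt] : exists m, m \notin pmap lev [:: p; q].
    have [pi|pi] := eqVneq p i.
      have qj : q != j by apply: contraNneq pqij => ->; rewrite pi.
      exists ord_max; rewrite mem_pmap !inE pi levi /=.
      have [->|qi] := eqVneq q i; first by rewrite levi.
      by rewrite levO.
    have [pj|pj] := eqVneq p j.
      have qi : q != i by apply: contraNneq pqji => ->; rewrite pj.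
      exists ord0; rewrite mem_pmap !inE pj levj /=.
      have [->|qj] := eqVneq q j; first by rewrite levj.
      by rewrite levO.
    have [->|qi] := eqVneq q i.
      by exists ord_max; rewrite mem_pmap !inE levO // levi.
    by exists ord0; rewrite mem_pmap !inE (levO p) //;
       have [->|qj] := eqVneq q j; rewrite ?levj ?levO.
  exact: Lmiss mt.
have := LFil _ aF; rewrite mulr_suml linear_sum.
under eq_bigr => p _ do rewrite mulr_sumr linear_sum.
rewrite pair_big /=.
have E (pq : 'I_n * 'I_n) : L (a pq.1 *: x pq.1 * (a pq.2 *: x pq.2)) =
    (a pq.1 * a pq.2) * c pq.1 pq.2.
  rewrite -[RHS]/((a pq.1 * a pq.2) *: L _) -linearZ; congr (L _).
  by apply/funext => C; rewrite hmono2; exact: mulrACA.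
under eq_bigr do rewrite E.
rewrite (bigD1 (i, j)) //= (bigD1 (j, i)) /=; last first.
  by rewrite xpair_eqE negb_and eq_sym ij.
rewrite big1 => [|[p q] /= /andP[pqij pqji]]; last by rewrite L0 // mulr0.
rewrite Lij Lji !mulr1 => /eqP.
rewrite addr0 [a j * a i]mulrC -mulr2n -mulr_natl.
move: char2; rewrite inE /= => two0.
by rewrite mulf_eq0 (negbTE two0) => /eqP.
Qed.

Lemma Fil1_linear (f : VG R A) : f \in Fil_pred 1 ->
  exists a : 'I_n -> R, f - \sum_i a i *: x i \in Fil_pred 0.
Proof.
move=> /(@Fil_span _ _ _ _ _ 1)[ts [ts1 ->]]; elim: ts ts1 => [|[c t] ts IHts] ts1.
  exists (fun=> 0); rewrite big_nil big1 ?subr0 ?rpred0 // => i _.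
  by rewrite scale0r.
have [|a aF] := IHts; first by move=> u uts; apply: ts1; rewrite inE uts orbT.
have := ts1 (c, t) (mem_head _ _); rewrite big_cons /=.
case: t {ts1} => [_|i [|//] _].
  by exists a; rewrite -addrA rpredD // rpredZ // /hmono big_nil one_Fil.
exists (fun j => (j == i)%:R * c + a j).
rewrite (_ : _ - _ = \sum_(t <- ts) t.1 *: hmono R t.2 - \sum_j a j *: x j) //.
under [X in _ - X = _]eq_bigr do rewrite scalerDl.
rewrite big_split /= (bigD1 i) //= eqxx mul1r [X in _ - (_ + X + _)]big1 => [|j /negbTE ->].
  by rewrite hmono1 addr0 opprD addrACA subrr add0r.
by rewrite mul0r scale0r.
Qed.

End DegreeOneTwo.

(** * Uniqueness of the relation attached to a circuit *)

Lemma oppr_div_gt0 (K : realFieldType) (x y : K) : x != 0 -> y != 0 ->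
  (0 < - (y / x)) = (x < 0) (+) (y < 0).
Proof.
move=> x0 y0; rewrite oppr_gt0; case: (ltgtP y 0) y0 => // yn _.
  by rewrite nmulr_rlt0 // invr_gt0 addbT; case: (ltgtP x 0) x0.
by rewrite pmulr_rlt0 // invr_lt0 addbF.
Qed.

Section CircuitUniqueness.
Variables (R : idomainType) (K : realType) (l n : nat) (A : arrangement K l n).
Hypothesis char2 : 2%N \notin [pchar R].

Lemma perm_hmono (s t : seq 'I_n) : perm_eq s t -> hmono R s = hmono R t :> VG R A.
Proof. by move=> st; rewrite /hmono (perm_big _ st). Qed.

(** A nonzero relation supported on [bs] would have all of [J] as its support, but it vanishes at
    [i]. *)
Lemma independent_sub (J : {set 'I_n}) k (bs : k.-tuple 'I_n) i :
  circuit A J -> uniq bs -> {subset bs <= J} -> i \in J -> i \notin bs ->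
  independent A bs.
Proof.
move=> cJ ubs bsJ iJ ibs; apply: independentI => // lam supp rel h.
apply/eqP/negPn/negP => lamh.
have J0 j : j \notin J -> lam j = 0.
  by move=> jJ; apply: supp; apply: contra jJ; exact: bsJ.
have := circuit_support cJ (ex_intro _ h lamh) J0 rel i.
by rewrite iJ supp // eqxx.
Qed.

(* The residue along j0 :: r' (r without i) reads off b i + (sign) * b j0: in that
   basis all coordinates of A i are nonzero, so i and j0 both have level 0. *)
Lemma circuit_coeff (J : {set 'I_n}) lam (b : 'I_n -> R) j0 r :
  circuit A J -> relation A lam -> (forall i, (i \in J) = (lam i != 0)) ->
  uniq (j0 :: r) -> j0 :: r =i J ->
  \sum_(i <- j0 :: r) b i *: @hmono R K l n A [seq j <- j0 :: r | j != i]
    \in Fil_pred ((size (j0 :: r))%:Z - 2) ->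
  forall i, i \in J -> b i = (-1) ^+ ((lam i < 0)%R (+) (lam j0 < 0)%R) * b j0.
Proof.
move=> cJ rel lamJ ujr jrJ bF i iJ.
have [->|ij0] := eqVneq i j0; first by rewrite addbb mul1r.
have ir : i \in r by move: iJ; rewrite -jrJ inE (negbTE ij0).
have [j0r ur] : j0 \notin r /\ uniq r by move: ujr; rewrite /= => /andP[].
have j0J : j0 \in J by rewrite -jrJ mem_head.
pose r' := [seq j <- r | j != i].
have memr' h : (h \in r') = (h != i) && (h \in r) by rewrite mem_filter.
have ur' : uniq r' by rewrite filter_uniq.
have rr' : perm_eq r (i :: r').
  by rewrite /r' -(rem_filter _ ur); exact: perm_to_rem.
pose bs := [tuple of j0 :: in_tuple r'].
pose ts := [tuple of i :: in_tuple r'].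
have ind : independent A bs.
  apply: (@independent_sub J _ bs i) => //=.
  - by rewrite memr' (negbTE j0r) andbF.
  - by move=> h; rewrite -jrJ !inE memr' => /orP[->//|/andP[_ ->]]; rewrite orbT.
  - by rewrite inE memr' eqxx /= orbF.
have [L [lev [s [LFil Lmiss Lt levN levS]]]] := residue_functional char2 ind.
have levb := basis_level levS.
have lami : lam i != 0 by rewrite -lamJ.
have lamj : lam j0 != 0 by rewrite -lamJ.
have Ai : A i = \sum_a (- (lam (tnth bs a) / lam i)) *: A (tnth bs a).
  have supp h : h \notin i :: bs -> lam h = 0.
    rewrite !inE memr' negb_or negb_or => /and3P[hi hj].
    rewrite hi /= => hr; apply/eqP/negPn; rewrite -lamJ -jrJ inE negb_or hj //.
  have uib : uniq (i :: bs) by rewrite /= !inE memr' eqxx orbF ij0 memr' (negbTE j0r) andbF.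
  move: rel; rewrite /relation (sum_support A uib supp) big_cons.
  rewrite -[bs : seq _]/(tval bs) big_tuple => /eqP; rewrite addr_eq0 => /eqP Ei.
  rewrite -[LHS]scale1r -(mulVf lami) -scalerA Ei -sumrN scaler_sumr.
  by apply: eq_bigr => a _; rewrite -scaleNr scalerA mulrN mulrC.
have [m [levi m0 _ si]] := levS i _ Ai.
have {m0} m0 : m = ord0.
  apply/val_inj/eqP; rewrite -leqn0 leqNgt; apply/negP => /(m0 ord0) /eqP.
  by rewrite oppr_eq0 mulf_eq0 invr_eq0 (negbTE lami) orbF tnth0 (negbTE lamj).
have sE : s i = (lam i < 0)%R (+) (lam j0 < 0)%R.
  by rewrite si m0 tnth0 oppr_div_gt0.
have tsE a : a != ord0 -> tnth ts a = tnth bs a.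
  by case: (unliftP ord0 a) => [a' ->|->]; rewrite ?eqxx // !tnthS.
have levts a : lev (tnth ts a) = Some a.
  have [->|a0] := eqVneq a ord0; first by rewrite tnth0 levi m0.
  by rewrite tsE //; case: (levb a).
pose Lh h : R := L (hmono R [seq j <- j0 :: r | j != h]).
have Lhi : Lh i = 1.
  rewrite /Lh /= eq_sym ij0 -[_ :: _]/(tval bs) Lt => [|a]; last by case: (levb a).
  by rewrite big1 // => a _; case: (levb a) => _ ->.
have Lhj0 : Lh j0 = (-1) ^+ (~~ s i).
  have /perm_hmono E : perm_eq [seq j <- j0 :: r | j != j0] (tval ts).
    rewrite /= eqxx (_ : [seq j <- r | j != j0] = r) //.
    by apply/all_filterP/allP => j jr; apply: contraNneq j0r => <-.
  rewrite /Lh E Lt // (bigD1 ord0) //= tnth0 big1 ?mulr1 // => a a0.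
  by rewrite tsE //; case: (levb a) => _ ->.
(* Omitting an [h] other than [i] and [j0] keeps both of these at level 0 and leaves nothing at the
   level of [h]. *)
have L0 h : h \in r' -> Lh h = 0.
  move=> hr'; have /tnthP[m' hm'] : h \in bs by rewrite inE hr' orbT.
  have m'0 : m' != ord0.
    apply: contraTneq hr' => m'0; rewrite hm' m'0 tnth0 memr' (negbTE j0r).
    by rewrite andbF.
  apply: (Lmiss _ m'); rewrite mem_pmap; apply/negP => /mapP[g].
  rewrite mem_filter => /andP[gh gjr] levg.
  have [gi|gi] := eqVneq g i.
    by move: levg m'0; rewrite gi levi m0 => -[->]; rewrite eqxx.
  have /tnthP[a ga] : g \in bs.
    by rewrite inE memr' gi; move: gjr; rewrite inE.
  move: levg gh; rewrite ga hm'; have [-> _] := levb a => -[->].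
  by rewrite eqxx.
(* With [k = (size r').+1] the length of [bs], the step [size (j0 :: r) - 2] is [k - 1], the one the
   residue kills. *)
have bFk : \sum_(h <- j0 :: r) b h *: @hmono R K l n A [seq j <- j0 :: r | j != h]
    \in Fil_pred ((size r').+1%:Z - 1).
  move: bF; congr (_ \in Fil_pred _).
  by rewrite /= (perm_size rr') /= -addn1 PoszD -addrA.
have : \sum_(h <- j0 :: r) b h * Lh h = 0.
  rewrite -[RHS](LFil _ bFk) linear_sum.
  by apply: eq_bigr => h _; rewrite linearZ.
rewrite big_cons (perm_big _ rr') big_cons Lhi Lhj0 mulr1.
rewrite big_seq big1 => [|h /L0 ->]; last by rewrite mulr0.
rewrite /= addr0 addrC => /eqP; rewrite addr_eq0 => /eqP ->.
by rewrite -sE mulrC; case: (s i); rewrite ?mulN1r ?mul1r ?opprK.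
Qed.

End CircuitUniqueness.

(** * Vanishing of monomials in the graded algebra *)

Section MonomialIndependence.
Variables (R : idomainType) (K : realType) (l n : nat) (A : arrangement K l n).
Hypothesis char2 : 2%N \notin [pchar R].
Local Notation x := (@heaviside R K l n A).

(** For independent forms the residue of the monomial is 1. Otherwise the factors in the support of
    a relation already drop one filtration step, and each remaining factor raises the step by one
    only. *)
Lemma hmono_Fil_free (S : seq 'I_n) (c : R) : uniq S -> c != 0 ->
  (c *: @hmono R K l n A S \in Fil_pred ((size S)%:Z - 1)) = ~~ free [seq A i | i <- S].
Proof.
move=> uS c0; apply/idP/idP => [cS|nfree].
  apply: contraNN c0 => /(freeE A (in_tuple S)) ind.
  have [L [LFil L1]] := residue_basis char2 ind.
  have := LFil _ cS; rewrite linearZ /= [L _]L1 => c0.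
  by apply/eqP; rewrite -[LHS]mulr1.
rewrite rpredZ //.
have [lam [i lami] [supp rel]] : exists2 lam : 'I_n -> K, exists i, lam i != 0 &
    (forall i, i \notin S -> lam i = 0) /\ relation A lam.
  apply: contrapT => norel; move/negP: nfree; apply.
  apply/(freeE A (in_tuple S)); apply: independentI => // lam supp rel i.
  by apply: contra_notP norel => li; exists lam; [exists i; exact/eqP | split].
pose T := [seq j <- S | lam j != 0].
have TE j : (j \in T) = (lam j != 0).
  rewrite mem_filter andb_idr // => lamj.
  by apply: contraNT lamj => /supp ->.
have T0 : (0 < size T)%N by have := TE i; rewrite lami -has_predT => iT; apply/hasP; exists i.
have TF := relation_hmono_Fil R (filter_uniq _ uS) TE T0 rel.
have -> : hmono R S = hmono R T * hmono R [seq j <- S | ~~ (lam j != 0)] :> VG R A.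
  have /permPl/perm_hmono <- := perm_filterC (fun j => lam j != 0) S.
  by rewrite /hmono big_cat.
have := Fil_mul TF (hmono_Fil R A [seq j <- S | ~~ (lam j != 0)]).
congr (_ \in Fil_pred _).
rewrite addrAC -PoszD; congr (_%:Z - 1).
by rewrite -(count_predC (fun j => lam j != 0) S) !size_filter.
Qed.

Lemma linear2_Fil0 (c d : R) i j : i != j ->
  c *: x i - d *: x j \in Fil_pred 0 -> c = 0.
Proof.
move=> ij cd.
pose a h := if h == i then c else if h == j then - d else 0.
have : \sum_h a h *: x h \in Fil_pred 0.
  rewrite (bigD1 i) //= (bigD1 j) ?[j == i]eq_sym //= {1 2}/a eqxx.
  rewrite eq_sym (negbTE ij) eqxx big1 ?addr0 ?scaleNr // => h /andP[hi hj].
  by rewrite /a (negbTE hi) (negbTE hj) scale0r.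
by move=> /(linear_Fil0 char2) /(_ i); rewrite /a eqxx.
Qed.

End MonomialIndependence.

(** * Minimal sets under a bijection, and signs in a domain *)

Lemma minset_imset (T1 T2 : finType) (f : T2 -> T1) (g : T1 -> T2)
    (P1 : pred {set T1}) (P2 : pred {set T2}) (J : {set T2}) :
  cancel f g -> cancel g f -> (forall B, P2 B = P1 (f @: B)%SET) ->
  minset P2 J = minset P1 (f @: J)%SET.
Proof.
move=> fK gK P12.
have fgK (B : {set T1}) : (f @: (g @: B))%SET = B.
  by rewrite -imset_comp -[RHS]imset_id; apply: eq_imset => i /=; rewrite gK.
apply/minsetP/minsetP => -[PJ minJ]; split; rewrite -?P12 // ?P12 // => B PB BJ.
  rewrite -(fgK B) (minJ (g @: B)%SET) ?P12 ?fgK //.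
  by apply/fintype.subsetP => _ /imsetP[i /(fintype.subsetP BJ)/imsetP[j jJ ->] ->]; rewrite fK.
apply: (imset_inj (can_inj fK)); apply: minJ; first by rewrite -P12.
exact: imsetS.
Qed.

Lemma sign_inj (R : idomainType) : 2%N \notin [pchar R] ->
  injective (fun b : bool => (-1) ^+ b : R).
Proof.
rewrite inE /= => two0 b b' bb'; apply/eqP; apply: contraNT two0 => neq.
have one1 : 1 = -1 :> R.
  by move: neq bb'; case: b; case: b' => //= _ ->.
by rewrite -[2%:R]/(1 + 1) {2}one1 subrr.
Qed.

(* E i is the sign of c i relative to a representative of its class modulo sign. *)
Lemma sign_class (R : idomainType) n (c : 'I_n -> R) :
  2%N \notin [pchar R] -> (forall i, c i != 0) ->
  exists E : 'I_n -> bool,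
    forall i j (b : bool), c j = (-1) ^+ b * c i -> E j = b (+) E i.
Proof.
rewrite inE /= => two0 c0.
pose P i h := (c h == c i) || (c h == - c i).
pose rep i := odflt i [pick h | P i h].
have repP i : P i (rep i).
  by rewrite /rep; case: pickP => [//|/(_ i)]; rewrite /P eqxx.
have repE i : c i = (-1) ^+ (c (rep i) != c i) * c (rep i).
  have [->|ne] := eqVneq (c (rep i)) (c i); first by rewrite mul1r.
  by have := repP i; rewrite /P (negbTE ne) => /eqP ->; rewrite mulN1r opprK.
exists (fun i => c (rep i) != c i) => i j b cij.
have ij : rep j = rep i.
  have PE : P j =1 P i.
    move=> h; rewrite /P cij; case: b {cij}; rewrite ?mulN1r ?mul1r //.
    by rewrite opprK orbC.
  rewrite /rep (eq_pick PE); case: pickP => // /(_ i).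
  by rewrite /P eqxx.
have := cij; rewrite {1}(repE j) {1}(repE i) ij mulrA -signr_addb.
move=> /(mulIf (c0 _)); apply: sign_inj; rewrite inE /=; exact: two0.
Qed.

(** * Transport along a graded isomorphism *)

Section Isomorphism.
Variables (R : idomainType) (K : realType) (l1 n1 l2 n2 : nat).
Variables (A1 : arrangement K l1 n1) (A2 : arrangement K l2 n2).
Hypothesis char2 : 2%N \notin [pchar R].
Hypothesis gen : generic_codim2 A1.
Variable phi : forall k, {linear grVG R A1 k -> grVG R A2 k}.
Hypothesis phi_bij : forall k, bijective (phi k).
Hypothesis phi1 : phi 0%N (gr_one R A1) = gr_one R A2.
Hypothesis phiM : forall i j (x : grVG R A1 i) (y : grVG R A1 j),
  phi (i + j)%N (gr_mul x y) = gr_mul (phi i x) (phi j y).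
Local Notation x1 := (@heaviside R K l1 n1 A1).
Local Notation x2 := (@heaviside R K l2 n2 A2).

Let x1_Fil i : x1 i \in Fil_pred 1%N%:Z. Proof. exact: heaviside_Fil. Qed.
Let x2_Fil i : x2 i \in Fil_pred 1%N%:Z. Proof. exact: heaviside_Fil. Qed.

Lemma heaviside_sqr (l n : nat) (A : arrangement K l n) i :
  @heaviside R K l n A i * heaviside R i = heaviside R i.
Proof.
apply/funext => C; rewrite -[LHS]/(heaviside R i C * heaviside R i C) /heaviside.
by case: asboolP; rewrite ?mulr1 ?mulr0.
Qed.

(* The preimage sum_i a_i x_i squares to 0, which makes all a_i a_h (i <> h) vanish
   by genericity. *)
Lemma preimage_heaviside j : exists (ic : 'I_n1 * R),
  ic.2 != 0 /\ phi 1%N (cls 1 (ic.2 *: x1 ic.1)) = cls 1 (x2 j).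
Proof.
have [psi psiK phiK] := phi_bij 1%N.
have [f f_Fil fE] := cls_surj (psi (cls 1 (x2 j))).
have [a aF] := Fil1_linear f_Fil.
pose S := \sum_i a i *: x1 i.
have S_Fil : S \in Fil_pred 1%N%:Z by rewrite rpred_sum // => i _; rewrite rpredZ.
have phiS : phi 1%N (cls 1 S) = cls 1 (x2 j).
  by rewrite -[RHS]phiK fE (cls_eq f_Fil S_Fil aF).
have SS : S * S \in Fil_pred 1.
  have SS2 : S * S \in Fil_pred 2%N%:Z by exact: (Fil_mul S_Fil S_Fil).
  suff : cls 2 (S * S) = 0 by move/(cls_eq0 SS2).
  apply: (bij_inj (phi_bij 2%N)); rewrite linear0.
  have := phiM (cls 1 S) (cls 1 S); rewrite cls_mul // phiS cls_mul // => ->.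
  by rewrite heaviside_sqr; apply/cls_eq0; exact: Fil_pred_le (x2_Fil j).
have aa := square_linear_Fil1 char2 gen SS.
(* Some coefficient is nonzero, since the class of [x2 j] is; the vanishing products [aa] then leave
   a single term in [S]. *)
have [i ai] : exists i, a i != 0.
  apply: contrapT => /forallNP a0.
  have S0 : S = 0.
    by rewrite /S big1 // => i _; move/negP/negPn/eqP: (a0 i) => ->; rewrite scale0r.
  have : 1 *: x2 j \in Fil_pred 0.
    rewrite scale1r; apply/(cls_eq0 (x2_Fil j)).
    by rewrite -phiS S0 cls0 linear0.
  by rewrite -hmono1 hmono_Fil_free ?oner_eq0 // seq1_free form_neq0.
exists (i, a i); split=> //=; rewrite -phiS /S (bigD1 i) //= big1 ?addr0 // => h hi.
by have /eqP := aa h i hi; rewrite mulf_eq0 (negbTE ai) orbF => /eqP ->; rewrite scale0r.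
Qed.

(** * The induced bijection of hyperplanes and its effect on circuits *)

Section Matching.
Variables (rho : 'I_n2 -> 'I_n1) (c : 'I_n2 -> R).
Hypothesis c0 : forall j, c j != 0.
Hypothesis phi_rho : forall j, phi 1%N (cls 1 (c j *: x1 (rho j))) = cls 1 (x2 j).

(** If [rho j = rho j'], both generators come from multiples of one class and are linearly dependent
    in degree one, which forces [j = j']. *)
Lemma rho_inj : injective rho.
Proof.
move=> j j' rjj; apply/eqP; apply: contraT => jj'.
have : c j' *: x2 j - c j *: x2 j' \in Fil_pred 0.
  apply/(@cls_eq0 _ _ _ _ _ 1); first by rewrite rpredB ?rpredZ.
  rewrite -scaleNr clsD ?rpredZ // !clsZ // -!phi_rho rjj !clsZ // !linearZ /=.
  by rewrite !scalerA mulrN mulrC scaleNr subrr.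
by move=> /(linear2_Fil0 char2 jj') /eqP; rewrite (negbTE (c0 j')).
Qed.

(** If [rho] missed [i], expanding the image of [x1 i] in the [x2 j] and pulling back would write
    the class of [x1 i] through the other generators. *)
Lemma rho_surj i : exists j, rho j = i.
Proof.
apply: contrapT => /forallNP nrho.
have [y y_Fil yE] := cls_surj (phi 1%N (cls 1 (x1 i))).
have [b bF] := Fil1_linear y_Fil.
pose S := \sum_j b j *: x2 j.
have S_Fil : S \in Fil_pred 1%N%:Z by rewrite rpred_sum // => j _; rewrite rpredZ.
have yS : cls 1 y = cls 1 S by exact: cls_eq y_Fil S_Fil bF.
pose T := \sum_j b j *: (c j *: x1 (rho j)).
have T_Fil : T \in Fil_pred 1%N%:Z by rewrite rpred_sum // => j _; rewrite !rpredZ.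
have : cls 1 (x1 i) = cls 1 T.
  apply: (bij_inj (phi_bij 1%N)); rewrite yE yS /S /T !cls_sum => [|j _|j _] //; last first.
    by rewrite rpredZ.
  by rewrite linear_sum; apply: eq_bigr => j _; rewrite linearZ phi_rho.
move=> /eqP; rewrite -subr_eq0 => /eqP E.
have : x1 i - T \in Fil_pred 0.
  apply/(@cls_eq0 _ _ _ _ _ 1); rewrite ?rpredB //.
  by rewrite -[- T]scaleN1r clsD ?rpredZ // clsZ // scaleN1r.
pose a h := (h == i)%:R - \sum_(j | rho j == h) b j * c j.
have -> : x1 i - T = \sum_h a h *: x1 h.
  under [RHS]eq_bigr do rewrite scalerBl scaler_suml.
  rewrite sumrB (bigD1 i) //= eqxx scale1r big1 ?addr0 => [|h /negbTE ->]; last first.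
    by rewrite scale0r.
  congr (_ - _); rewrite (exchange_big_dep xpredT) //=; apply: eq_bigr => j _.
  by rewrite (big_pred1 (rho j)) ?scalerA // => h; rewrite eq_sym.
move=> /(linear_Fil0 char2) /(_ i) /eqP; rewrite /a eqxx big1 ?subr0 ?oner_eq0 // => j.
by move=> /eqP /nrho.
Qed.

Lemma phi_hmono k (S : seq 'I_n2) : size S = k ->
  phi k (cls k ((\prod_(j <- S) c j) *: hmono R [seq rho j | j <- S])) =
  cls k (hmono R S).
Proof.
move=> <-; elim: S => [|j S IHS] /=.
  by rewrite big_nil scale1r /hmono !big_nil !cls_one.
have := phiM (cls 1 (c j *: x1 (rho j)))
  (cls (size S) ((\prod_(j <- S) c j) *: hmono R [seq rho j | j <- S])).
have mono_Fil : hmono R [seq rho j | j <- S] \in @Fil_pred R _ _ _ A1 (size S)%:Z.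
  by rewrite -(size_map rho) hmono_Fil.
rewrite IHS phi_rho !cls_mul ?hmono_Fil ?rpredZ //.
rewrite [x2 j * _](_ : _ = hmono R (j :: S)); last by rewrite /hmono big_cons.
move=> <-; congr (phi _ (cls _ _)).
rewrite /hmono /= !big_cons; apply/funext => C; exact: mulrACA.
Qed.

(** By [phi_hmono] the isomorphism matches the two classes of degree [k], and being injective it
    preserves and reflects vanishing. *)
Lemma Fil_rho k (I : eqType) (ts : seq I) (b : I -> R) (S : I -> seq 'I_n2) :
  (forall t, t \in ts -> size (S t) = k) ->
  (\sum_(t <- ts) b t *: @hmono R K l2 n2 A2 (S t) \in Fil_pred (k%:Z - 1)) =
  (\sum_(t <- ts) (b t * \prod_(j <- S t) c j) *:
     @hmono R K l1 n1 A1 [seq rho j | j <- S t] \in Fil_pred (k%:Z - 1)).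
Proof.
move=> tsk.
have F2 t : t \in ts -> @hmono R K l2 n2 A2 (S t) \in Fil_pred k%:Z.
  by move=> /tsk <-; exact: hmono_Fil.
have F1 t : t \in ts -> @hmono R K l1 n1 A1 [seq rho j | j <- S t] \in Fil_pred k%:Z.
  by move=> /tsk <-; rewrite -(size_map rho) hmono_Fil.
have E : phi k (cls k (\sum_(t <- ts) (b t * \prod_(j <- S t) c j) *:
     @hmono R K l1 n1 A1 [seq rho j | j <- S t])) =
   cls k (\sum_(t <- ts) b t *: @hmono R K l2 n2 A2 (S t)).
  rewrite !cls_sum // linear_sum big_seq [RHS]big_seq; apply: eq_bigr => t tts.
  by rewrite -(phi_hmono (tsk t tts)) clsZ ?F1 // !linearZ /= scalerA mulrC.
have G1 : \sum_(t <- ts) (b t * \prod_(j <- S t) c j) *: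
     @hmono R K l1 n1 A1 [seq rho j | j <- S t] \in Fil_pred k%:Z.
  by rewrite big_seq rpred_sum // => t tts; rewrite rpredZ // F1.
have G2 : \sum_(t <- ts) b t *: @hmono R K l2 n2 A2 (S t) \in Fil_pred k%:Z.
  by rewrite big_seq rpred_sum // => t tts; rewrite rpredZ // F2.
apply/idP/idP => [/(cls_eq0 G2)|/(cls_eq0 G1)] H0; apply/cls_eq0 => //.
  by apply: (bij_inj (phi_bij k)); rewrite E H0 linear0.
by rewrite -E H0 linear0.
Qed.

(** Independence means that the monomial has nonzero class; [Fil_rho] for a single monomial carries
    this over, with a nonzero scalar. *)
Lemma free_rho (S : seq 'I_n2) : uniq S ->
  free [seq A2 j | j <- S] = free [seq A1 i | i <- [seq rho j | j <- S]].
Proof.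
move=> uS; apply: negb_inj.
have uS1 : uniq [seq rho j | j <- S] by rewrite map_inj_uniq //; exact: rho_inj.
have cS : \prod_(j <- S) c j != 0.
  by rewrite prodf_seq_neq0; apply/allP => j _; exact: c0.
rewrite -(hmono_Fil_free A2 char2 uS (oner_neq0 R)).
rewrite -(hmono_Fil_free A1 char2 uS1 cS) size_map.
have := @Fil_rho (size S) _ [:: tt] (fun=> 1) (fun=> S) (fun _ _ => erefl).
by rewrite !big_seq1 mul1r.
Qed.

Variable p : 'I_n1 -> 'I_n2.
Hypotheses (rhoK : cancel rho p) (pK : cancel p rho).

Lemma circuit_rho (J : {set 'I_n2}) : circuit A2 J = circuit A1 (rho @: J)%SET.
Proof.
apply: (minset_imset _ rhoK pK) => B; congr (~~ _).
rewrite -[LHS]/(free [seq A2 j | j <- enum B]) free_rho ?enum_uniq //.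
apply: perm_free; apply: perm_map; apply: uniq_perm; rewrite ?enum_uniq //.
  by rewrite map_inj_uniq ?enum_uniq //; exact: rho_inj.
move=> i; rewrite mem_enum; apply/mapP/imsetP => -[j jB ->]; exists j => //.
  by rewrite mem_enum in jB.
by rewrite mem_enum.
Qed.

(** The relation of [J] transports to [rho @: J] with coefficients [sg2 j] times the product of the
    [c h], [h != j]; [circuit_coeff] then compares any two of them. *)
Lemma circuit_coeff_rho (J : {set 'I_n2}) lam1 lam2 j0 j :
  circuit A2 J -> relation A2 lam2 -> (forall i, (i \in J) = (lam2 i != 0)) ->
  relation A1 lam1 -> (forall i, (i \in (rho @: J)%SET) = (lam1 i != 0)) ->
  j0 \in J -> j \in J ->
  c j0 = (-1) ^+ ((lam2 j < 0)%R (+) (lam1 (rho j) < 0)%R (+)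
                  ((lam2 j0 < 0)%R (+) (lam1 (rho j0) < 0)%R)) * c j.
Proof.
move=> cJ rel2 J2 rel1 J1 j0J jJ.
pose r := enum (J :\ j0)%SET.
have js_uniq : uniq (j0 :: r) by rewrite /= mem_enum !inE eqxx enum_uniq.
have jsE : j0 :: r =i J.
  by move=> i; rewrite inE mem_enum !inE; case: eqP => //= ->; rewrite j0J.
have js2 i : (i \in j0 :: r) = (lam2 i != 0) by rewrite jsE.
have := relation_derivative_Fil R js_uniq js2 isT rel2.
have sizeS i : i \in j0 :: r -> size [seq j <- j0 :: r | j != i] = size r.
  move=> ijs; rewrite -[RHS]/(size (j0 :: r)).-1 -(size_rem ijs).
  by rewrite (rem_filter _ js_uniq).
have -> : (size (j0 :: r))%:Z - 2 = (size r)%:Z - 1.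
  by rewrite /= -addn1 PoszD -addrA.
rewrite (Fil_rho _ sizeS).
pose sg2 i : R := (-1) ^+ (lam2 i < 0)%R.
pose b i := sg2 (p i) * \prod_(h <- [seq h <- j0 :: r | h != p i]) c h.
have -> : \sum_(i <- j0 :: r) ((-1) ^+ (lam2 i < 0)%R *
      \prod_(h <- [seq h <- j0 :: r | h != i]) c h) *:
    @hmono R K l1 n1 A1 [seq rho h | h <- [seq h <- j0 :: r | h != i]] =
  \sum_(i <- rho j0 :: [seq rho h | h <- r]) b i *:
    @hmono R K l1 n1 A1 [seq h <- rho j0 :: [seq rho h | h <- r] | h != i].
  rewrite -[_ :: [seq _ | _ <- r]]/[seq rho h | h <- j0 :: r] big_map.
  apply: eq_bigr => i _; rewrite /b rhoK; congr (_ *: hmono R _).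
  rewrite filter_map; congr [seq _ | _ <- _]; apply: eq_filter => h /=.
  by rewrite (inj_eq rho_inj).
have cI : circuit A1 (rho @: J)%SET by rewrite -circuit_rho.
have rs_uniq : uniq (rho j0 :: [seq rho h | h <- r]).
  by rewrite -[_ :: _]/(map rho (j0 :: r)) map_inj_uniq //; exact: rho_inj.
have rsE : rho j0 :: [seq rho h | h <- r] =i (rho @: J)%SET.
  move=> i; rewrite -[_ :: _]/(map rho (j0 :: r)); apply/mapP/imsetP => -[h hJ ->];
    by exists h => //; rewrite ?jsE // -jsE.
have -> : (size r)%:Z - 1 = (size (rho j0 :: [seq rho h | h <- r]))%:Z - 2.
  by rewrite /= size_map -[X in X%:Z - 2]addn1 PoszD -addrA.
move=> /(circuit_coeff char2 cI rel1 J1 rs_uniq rsE) /(_ (rho j) (imset_f _ jJ)).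
rewrite /b !rhoK; set C := \prod_(h <- j0 :: r) c h.
have CE i : i \in J -> C = c i * \prod_(h <- [seq h <- j0 :: r | h != i]) c h.
  by move=> iJ; rewrite /C big_filter (bigD1_seq i) //= jsE.
have C0 : C != 0 by rewrite prodf_seq_neq0; apply/allP => i _; exact: c0.
(* The factor [c j * c j0] completes both partial products to the full product [C], which is nonzero
   and cancels. *)
move=> /(congr1 (fun x => c j * c j0 * x)).
rewrite /sg2 !signr_addb.
set P := \prod_(h <- [seq h <- _ | h != j]) _; set P0 := \prod_(h <- _) _ => E.
have {}E : C * ((-1) ^+ (lam2 j < 0)%R * c j0) =
    C * ((-1) ^+ (lam1 (rho j) < 0)%R * (-1) ^+ (lam1 (rho j0) < 0)%R *
         (-1) ^+ (lam2 j0 < 0)%R * c j).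
  rewrite {1}(CE j jJ) (CE j0 j0J) -/P -/P0.
  transitivity (c j * c j0 * ((-1) ^+ (lam2 j < 0)%R * P)); first by ring.
  by rewrite E; ring.
move/(mulfI C0): E => /(congr1 (fun x => (-1) ^+ (lam2 j < 0)%R * x)).
by rewrite mulrA -signr_addb addbb mul1r => ->; ring.
Qed.

End Matching.

End Isomorphism.

(** * Signed circuits and the reorientation *)

Lemma sgz_sign (K : realDomainType) (x : K) :
  sgz x = if x == 0 then 0 else (-1) ^+ (x < 0)%R.
Proof.
case: (ltgtP x 0) => [x0|x0|->]; last by rewrite sgz0.
  by rewrite ltr0_sgz.
by rewrite gtr0_sgz.
Qed.

Lemma signed_circuitsI (K : realType) (l n : nat) (A : arrangement K l n) J lam (b : bool) :
  circuit A J -> relation A lam -> (forall i, (i \in J) = (lam i != 0)) ->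
  signed_circuits A [ffun i => (-1) ^+ b * sgz (lam i)].
Proof.
move=> cJ rel J0; exists J; split=> //; exists (fun i => (-1) ^+ b * lam i); split.
- have /card_gt0P[i] := circuit_neq0 cJ; rewrite J0 => lami; exists i.
  by rewrite mulf_neq0 // signr_eq0.
- by move=> i; rewrite J0 negbK => /eqP ->; rewrite mulr0.
- under eq_bigr do rewrite -scalerA.
  rewrite -scaler_sumr big_mkcond /= (_ : \sum_i _ = 0) ?scaler0 // -[RHS]rel.
  by apply: eq_bigr => i _; rewrite J0; case: eqP => //= ->; rewrite scale0r.
by apply/ffunP => i; rewrite !ffunE sgzM; case: b; rewrite ?sgz1 ?sgzN1.
Qed.

Lemma signed_circuitsE (K : realType) (l n : nat) (A : arrangement K l n) s :
  signed_circuits A s -> exists J lam,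
  [/\ circuit A J, relation A lam, forall i, (i \in J) = (lam i != 0)
    & s = [ffun i => sgz (lam i)]].
Proof.
move=> [J [cJ [lam [nz J0 rel sE]]]]; exists J, lam.
have rel' : relation A lam.
  rewrite /relation -[RHS]rel [RHS]big_mkcond /=; apply: eq_bigr => i _.
  by case: ifPn => // /J0 ->; rewrite scale0r.
by split=> //; exact: circuit_support cJ nz J0 rel'.
Qed.

Theorem theorem5p3 (R : idomainType) (K : realType) (l1 n1 l2 n2 : nat)
    (A1 : arrangement K l1 n1) (A2 : arrangement K l2 n2) :
  2%N \notin [pchar R] ->
  generic_codim2 A1 ->
  grVG_isom R A1 A2 ->
  signed_circuits_isom (signed_circuits A1) (signed_circuits A2).
Proof.
move=> char2 gen [phi [phi_bij phi1 phiM]].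
have [ic icP] := @fin_all_exists 'I_n2 (fun=> ('I_n1 * R)%type) _
  (preimage_heaviside char2 gen phi_bij phiM).
pose rho j := (ic j).1; pose c j := (ic j).2.
have c0 j : c j != 0 by case: (icP j).
have phi_rho j : phi 1%N (cls 1 (c j *: @heaviside R K l1 n1 A1 (rho j))) =
    cls 1 (@heaviside R K l2 n2 A2 j) by case: (icP j).
have [p pK] := @fin_all_exists 'I_n1 (fun=> 'I_n2) _ (rho_surj char2 phi_bij phi_rho).
have rhoK : cancel rho p by move=> j; apply: (rho_inj char2 c0 phi_rho); rewrite pK.
have circ := circuit_rho char2 phi_bij phi1 phiM c0 phi_rho rhoK pK.
have [E EP] := sign_class char2 c0.
(* Reorienting the signs of [J] gives those of [rho @: J] up to one global sign, which the set of
   signed circuits absorbs. *)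
have signs J lam1 lam2 : circuit A2 J ->
    relation A2 lam2 -> (forall i, (i \in J) = (lam2 i != 0)) ->
    relation A1 lam1 -> (forall i, (i \in (rho @: J)%SET) = (lam1 i != 0)) ->
    exists b : bool, [ffun i => (-1) ^+ E (p i) * sgz (lam2 (p i))] =
      [ffun i => (-1) ^+ b * sgz (lam1 i)].
  move=> cJ rel2 J2 rel1 J1.
  have /card_gt0P[j0 j0J] := circuit_neq0 cJ.
  (* The global sign is read at a chosen [j0] in [J]; [circuit_coeff_rho] and [EP] carry it to all
     of [J]. *)
  exists (E j0 (+) ((lam2 j0 < 0)%R (+) (lam1 (rho j0) < 0)%R)).
  apply/ffunP => i; rewrite !ffunE !sgz_sign.
  have lam12 : (lam2 (p i) == 0) = (lam1 i == 0).
    apply: negb_inj; rewrite -J2 -J1 -{2}[i]pK mem_imset //.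
    exact: can_inj rhoK.
  rewrite lam12; case: eqP => [_|/eqP lami]; first by rewrite !mulr0.
  have piJ : p i \in J by rewrite J2 lam12.
  have := circuit_coeff_rho char2 phi_bij phi1 phiM c0 phi_rho rhoK pK
    cJ rel2 J2 rel1 J1 j0J piJ.
  rewrite pK => /EP ->; rewrite -!signr_addb; congr (_ ^+ nat_of_bool _).
  by case: (E (p i)); case: (lam2 (p i) < 0)%R; case: (lam1 i < 0)%R;
    case: (lam2 j0 < 0)%R; case: (lam1 (rho j0) < 0)%R.
exists p, (fun i => E (p i)); split; first by exists rho.
split.
- move=> _ /signed_circuitsE[J [lam2 [cJ rel2 J2 ->]]].
  have [lam1 rel1 J1] := circuit_relation (etrans (esym (circ J)) cJ).
  have [b sb] := signs J lam1 lam2 cJ rel2 J2 rel1 J1.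
  have -> : [ffun i => (-1) ^+ E (p i) * [ffun i => sgz (lam2 i)] (p i)] =
      [ffun i => (-1) ^+ E (p i) * sgz (lam2 (p i))].
    by apply/ffunP => i; rewrite !ffunE.
  rewrite /= sb; apply: (signed_circuitsI b _ rel1 J1).
  by rewrite -circ.
- move=> s s' _ _ /ffunP ss'; apply/ffunP => j.
  by have := ss' (rho j); rewrite !ffunE rhoK; apply: mulfI; rewrite signr_eq0.
move=> _ /signed_circuitsE[I [lam1 [cI rel1 J1 ->]]].
pose J := (p @: I)%SET.
have rhoJ : (rho @: J)%SET = I.
  by rewrite -imset_comp -[RHS]imset_id; apply: eq_imset => i /=; rewrite pK.
have cJ : circuit A2 J by rewrite circ rhoJ.
have [lam2 rel2 J2] := circuit_relation cJ.
have [|b sb] := signs J lam1 lam2 cJ rel2 J2 rel1; first by rewrite rhoJ.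
(* The global sign goes into the preimage, as [lam2] may be negated. *)
exists [ffun j => (-1) ^+ b * sgz (lam2 j)].
  exact: signed_circuitsI b cJ rel2 J2.
apply/ffunP => i; move/ffunP/(_ i): sb; rewrite !ffunE => sb.
by rewrite mulrCA sb mulrA -signr_addb addbb mul1r.
Qed.
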